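(* Let $\mathcal{A}$ be a finite set, let $\mathcal{A}^{\mathbb{Z}}$ be a group shift, and let $\Phi:\mathcal{A}^{\mathbb{Z}}\to\mathcal{A}^{\mathbb{Z}}$ be a bipermutative endomorphic cellular automaton. Suppose that $\ker(\Phi)$ contains no nontrivial $\sigma$-invariant subgroups. If $\mu$ is a (Borel probability) measure on $\mathcal{A}^{\mathbb{Z}}$ which is $\Phi$-invariant and totally $\sigma$-ergodic, and $h_\mu(\Phi)>0$, then $\mu=\lambda$, the uniform Bernoulli measure on $\mathcal{A}^{\mathbb{Z}}$.
   Context: $\mathcal{A}^{\mathbb{Z}}$ has the product topology ($\mathcal{A}$ discrete); $\sigma$ is the shift, $\sigma(\mathbf{a})_z=a_{z-1}$. A group shift is the space $\mathcal{A}^{\mathbb{Z}}$ equipped with a topological group structure such that $\sigma$ is a group automorphism. A cellular automaton is a continuous map $\Phi:\mathcal{A}^{\mathbb{Z}}\to\mathcal{A}^{\mathbb{Z}}$ commuting with $\sigma$; equivalently, there are $\ell,r\ge 0$ and a local rule $\phi:\mathcal{A}^{[-\ell..r]}\to\mathcal{A}$ (where $[-\ell..r]=\{-\ell,\ldots,r\}$) with $\Phi(\mathbf{a})_z=\phi(a_{z-\ell},\ldots,a_{z+r})$ for all $\mathbf{a}\in\mathcal{A}^{\mathbb{Z}}$ and $z\in\mathbb{Z}$. $\Phi$ is right-permutative if, for every fixed choice of the first $\ell+r$ arguments (those at positions $-\ell,\ldots,r-1$), $\phi$ is a bijection $\mathcal{A}\to\mathcal{A}$ as a function of its last argument; it is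 left-permutative if, for every fixed choice of the last $\ell+r$ arguments (those at positions $-\ell+1,\ldots,r$), $\phi$ is a bijection $\mathcal{A}\to\mathcal{A}$ as a function of its first argument; it is bipermutative if it is both left- and right-permutative. $\Phi$ is endomorphic if it is a group endomorphism of the group $\mathcal{A}^{\mathbb{Z}}$. A nontrivial subgroup of $\ker(\Phi)$ means one which is neither the identity subgroup nor all of $\ker(\Phi)$; a subgroup $\mathcal{J}$ is $\sigma$-invariant if $\sigma(\mathcal{J})=\mathcal{J}$. $\mu$ is totally $\sigma$-ergodic if it is $\sigma$-invariant and ergodic for $\sigma^n$ for every $n\ge1$. $h_\mu(\Phi)$ is the measure-theoretic entropy of the system $(\mathcal{A}^{\mathbb{Z}},\Phi,\mu)$. $\lambda$ is the product measure assigning each cylinder set specifying $M$ coordinates the mass $|\mathcal{A}|^{-M}$. *)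

(* Defs.v *)
From HB Require Import structures.
From mathcomp Require Import all_boot all_order all_algebra.
From mathcomp Require Import all_classical all_reals all_analysis.
Import Order.TTheory GRing.Theory Num.Theory.
Import numFieldNormedType.Exports.
Set Implicit Arguments.
Unset Strict Implicit.
Unset Printing Implicit Defensive.
Local Open Scope classical_set_scope.
Local Open Scope ring_scope.

(* A nonempty finite set.  The marked point is only there because the library
   requires measurable types to be pointed; its choice is immaterial. *)
#[short(type=pfinType)]
HB.structure Definition PointedFinite := {T of Finite T & Pointed T}.

Definition config (A : pfinType) : Type := {ptws int -> discrete_topology A}.

HB.instance Definition _ (A : pfinType) := Pointed.on (config A).
HB.instance Definition _ (A : pfinType) := Topological.on (config A).
(* The Borel sigma-algebra of the product topology. *)
HB.instance Definition _ (A : pfinType) :=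
  Measurable.copy (config A) (g_sigma_algebraType (@open (config A))).

Definition cshift (A : pfinType) (a : config A) : config A := fun z => a (z - 1).

(* [cshift] is always a homeomorphism, so being multiplicative is all that is
   needed for it to be an automorphism. *)
Record group_shift (A : pfinType) := GroupShift {
  gmul : config A -> config A -> config A;
  gone : config A;
  ginv : config A -> config A;
  gmulA : associative gmul;
  gmul1 : left_id gone gmul;
  gmulV : left_inverse gone ginv gmul;
  gmul_continuous : continuous (fun p : config A * config A => gmul p.1 p.2);
  ginv_continuous : continuous ginv;
  shift_gmul : {morph @cshift A : a b / gmul a b}
}.

Section GroupShift.
Context {A : pfinType} (G : group_shift A).

Definition endomorphic (Phi : config A -> config A) :=
  {morph Phi : a b / gmul G a b}.

Definition group_kernel (Phi : config A -> config A) : set (config A) :=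
  [set a | Phi a = gone G].

Definition is_subgroup (J : set (config A)) :=
  [/\ J (gone G),
      forall a b, J a -> J b -> J (gmul G a b) &
      forall a, J a -> J (ginv G a)].

Definition shift_invariant_set (J : set (config A)) := @cshift A @` J = J.

Definition nontrivial_subgroup_of (K J : set (config A)) :=
  [/\ is_subgroup J, J `<=` K, J <> [set gone G] & J <> K].

End GroupShift.

Section CellularAutomata.
Context {A : pfinType}.

Definition cellular_automaton (Phi : config A -> config A) :=
  continuous Phi /\ forall a, Phi (cshift a) = cshift (Phi a).

(* Entry i of the tuple fed to [phi] sits at position i - l, so the entries run
   over the positions -l, ..., r. *)
Definition has_local_rule (Phi : config A -> config A) (l r : nat)
    (phi : (l + r).+1.-tuple A -> A) :=
  forall (a : config A) (z : int),
    Phi a z = phi [tuple a (z - l%:Z + (i : nat)%:Z) | i < (l + r).+1].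

Definition right_permutative_rule n (phi : n.+1.-tuple A -> A) :=
  forall t : n.-tuple A, bijective (fun x : A => phi [tuple of rcons t x]).

Definition left_permutative_rule n (phi : n.+1.-tuple A -> A) :=
  forall t : n.-tuple A, bijective (fun x : A => phi [tuple of x :: t]).

Definition bipermutative (Phi : config A -> config A) :=
  exists (l r : nat) (phi : (l + r).+1.-tuple A -> A),
    [/\ has_local_rule Phi phi,
        left_permutative_rule phi &
        right_permutative_rule phi].

End CellularAutomata.

Section Dynamics.
Context {d : measure_display} {T : measurableType d} {R : realType}.
Variable mu : probability T R.

Definition measure_invariant (F : T -> T) :=
  forall B, measurable B -> mu (F @^-1` B) = mu B.

Definition ergodic (F : T -> T) :=
  forall B, measurable B -> F @^-1` B = B -> mu B = 0%E \/ mu B = 1%E.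

(* A finite measurable partition with cells indexed by 'I_k is given by the
   function P sending a point to the index of its cell (cells may be empty). *)
Definition measurable_partition k (P : T -> 'I_k) :=
  forall i, measurable (P @^-1` [set i]).

(* The cells of the join of the F^-i P, i < n, are indexed by words w. *)
Definition join_cell (F : T -> T) k (P : T -> 'I_k) n (w : n.-tuple 'I_k) :=
  [set x | forall i : 'I_n, P (iter i F x) = tnth w i].

(* As [ln 0 = 0], cells of measure 0 contribute 0. *)
Definition join_entropy (F : T -> T) k (P : T -> 'I_k) (n : nat) : R :=
  - \sum_(w : n.-tuple 'I_k)
      fine (mu (join_cell F P w)) * ln (fine (mu (join_cell F P w))).

Definition partition_entropy (F : T -> T) k (P : T -> 'I_k) : R :=
  limn (fun n => join_entropy F P n / n%:R).

Definition entropy (F : T -> T) : \bar R :=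
  ereal_sup [set h | exists k (P : T -> 'I_k),
    measurable_partition P /\ h = (partition_entropy F P)%:E].

End Dynamics.

Section Measures.
Context {A : pfinType} {R : realType}.

Definition totally_shift_ergodic (mu : probability (config A) R) :=
  measure_invariant mu (@cshift A) /\
  forall n, (1 <= n)%N -> ergodic mu (iter n (@cshift A)).

(* The coordinates in s are specified; the values of w outside s are ignored. *)
Definition cylinder (s : seq int) (w : int -> A) : set (config A) :=
  [set a | forall z, z \in s -> a z = w z].

Definition is_uniform_bernoulli (nu : probability (config A) R) :=
  forall (s : seq int) (w : int -> A), uniq s ->
    nu (cylinder s w) = ((#|A|%:R ^- size s)%R)%:E.

End Measures.

Section BorelConfig.
Context {A : pfinType}.
Lemma nbhs_cylinder (a : config A) (U : set (config A)) :
  nbhs a U -> exists s : seq int, cylinder s a `<=` U.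
Proof.
pose F : set_system (config A) := [set V | exists s : seq int, cylinder s a `<=` V].
have FF : Filter F.
  split; first by exists [::].
  - move=> V W [s sV] [t tW]; exists (s ++ t) => b bst; split.
      by apply: sV => z zs; apply: bst; rewrite mem_cat zs.
    by apply: tW => z zs; apply: bst; rewrite mem_cat zs orbT.
  - by move=> V W VW [s sV]; exists s; exact: subset_trans VW.
suff : F --> a by apply.
apply/cvg_sup => i V [/= _ [[C oC <-] Ca] CV].
exists [:: i] => b bi; apply: CV => /=.
by rewrite bi ?mem_head.
Qed.

Lemma config_measurable_fun d (T : measurableType d) (f : T -> config A) :
  (forall z (x : A), measurable [set t | f t z = x]) -> measurable_fun setT f.
Proof.
move=> mf.
apply: (@measurability _ _ T (config A) setT f (@open (config A))) => //.
move=> _ [U oU <-]; rewrite setTI.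
pose C (l : seq (int * A)) := [set t | all (fun p => f t p.1 == p.2) l].
pose D := [set l : seq (int * A) |
  [set b : config A | all (fun p => b p.1 == p.2) l] `<=` U].
have -> : f @^-1` U = \bigcup_l (if l \in D then C l else set0).
  apply/seteqP; split=> [t Ut|t [l _]]; last first.
    by case: ifPn => // /[!inE] lD Cl; apply: lD.
  have /nbhs_cylinder[s sU] : nbhs (f t) U by apply: open_nbhs_nbhs.
  exists [seq (z, f t z) | z <- s] => //.
  rewrite ifT; last first.
    rewrite inE => b /=; rewrite all_map => /allP bs; apply: sU => z zs.
    by apply/eqP; exact: (bs z zs).
  by rewrite /C /= all_map; apply/allP => z zs /=.
apply: countable_bigcupT_measurable => // l; case: ifPn => // _.
elim: l => [|[z x] l IHl].
  by rewrite (_ : C _ = setT) //; exact/seteqP.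
rewrite (_ : C _ = [set t | f t z = x] `&` C l); first exact: measurableI.
apply/seteqP; split=> t.
  by rewrite /C /= => /andP[/eqP].
by rewrite /C /= => -[-> ->]; rewrite eqxx.
Qed.
End BorelConfig.

Section UniformBernoulli.
Context {A : pfinType} {R : realType}.
Local Notation N := #|A|.

Lemma card_alphabet_gt0 : (0 < N)%N. Proof. by apply/card_gt0P; exists point. Qed.
Let NR0 n : 0 < N%:R ^+ n :> R. Proof. by rewrite exprn_gt0// ltr0n card_alphabet_gt0. Qed.

(* To build the measure, read off the base-#|A| digits of a uniform point of
   [0, 1[: [prefix n x] is the integer coded by the first n digits of x. *)
Definition prefix (n : nat) (x : R) : nat := Num.truncn (x * N%:R ^+ n).

Definition prefix_itv n j : set R := [set` `[j%:R / N%:R ^+ n, j.+1%:R / N%:R ^+ n[].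

Lemma prefixE n (x : R) j : 0 <= x -> prefix n x = j <-> prefix_itv n j x.
Proof.
move=> x0; rewrite /prefix_itv /= in_itv /= ler_pdivrMr// ltr_pdivlMr//.
rewrite /prefix -truncn_eq; first by split => /eqP.
by rewrite mulr_ge0// ltW.
Qed.

Lemma prefix_div n x : 0 <= x -> (prefix n.+1 x %/ N = prefix n x)%N.
Proof.
move=> x0; symmetry; apply/prefixE => //.
have /prefixE : prefix n.+1 x = prefix n.+1 x by []. move=> /(_ x0).
set j := prefix _ _; rewrite /prefix_itv /= !in_itv /= => /andP[h1 h2].
have jE : j%:R = (j %/ N)%:R * N%:R + (j %% N)%:R :> R.
  by rewrite -natrM -natrD -divn_eq.
have j2 : (j.+1 <= (j %/ N).+1 * N)%N.
  by rewrite mulSn addnC {1}(divn_eq j N) ltn_add2l ltn_mod card_alphabet_gt0.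
apply/andP; split.
  apply: le_trans h1; rewrite ler_pdivlMr// exprSr mulrA divfK ?gt_eqF//.
    by rewrite -natrM ler_nat leq_trunc_div.
apply: (lt_le_trans h2); rewrite ler_pdivrMr// exprSr mulrA divfK ?gt_eqF//.
by rewrite -natrM ler_nat.
Qed.

Definition digit (k : nat) (x : R) : A := nth point (enum A) (prefix k.+1 x %% N).

Lemma digitE k x (a : A) : (digit k x = a) <-> (prefix k.+1 x %% N = index a (enum A))%N.
Proof.
have lt : (prefix k.+1 x %% N < size (enum A))%N by rewrite -cardE ltn_mod card_alphabet_gt0.
split => [<-|e]; rewrite /digit; last by rewrite e nth_index ?mem_enum.
by rewrite index_uniq// enum_uniq.
Qed.

Definition digits (x : R) : config A := fun z => digit (pickle z) x.

Lemma measurable_digits : measurable_fun [set: R] digits.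
Proof.
apply: config_measurable_fun => z a; rewrite /digits.
set k := pickle z.
pose P := [set j : nat | (j %% N = index a (enum A))%N].
have -> : [set x : R | digit k x = a] =
   \bigcup_(j in P) [set x | prefix k.+1 x = j].
  apply/seteqP; split=> [x /digitE h|x [j Pj /= h]].
    by exists (prefix k.+1 x).
  by apply/digitE; rewrite h.
apply: bigcup_measurable => j _.
have -> : [set x | prefix k.+1 x = j] =
   ([set` `[0, +oo[] `&` prefix_itv k.+1 j) `|` (if j == 0%N then [set` `]-oo, 0[] else set0).
  apply/seteqP; split=> x /=.
    move=> h; have [x0|x0] := leP 0 x.
      by left; split; rewrite /= ?in_itv /= ?andbT//; apply/prefixE.
    have : prefix k.+1 x = 0%N.
      by apply/truncn0Pn; rewrite -ltNge (@le_lt_trans _ _ 0)// nmulr_rle0// ltW.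
    by rewrite h => ->; right; rewrite eqxx /= in_itv.
  move=> [[]|]; first by rewrite /= in_itv /= andbT => x0 /prefixE; exact.
  case: eqVneq => // ->; rewrite /= in_itv /= => x0.
  by apply/truncn0Pn; rewrite -ltNge (@le_lt_trans _ _ 0)// nmulr_rle0// ltW.
apply: measurableU; first by apply: measurableI; exact: measurable_itv.
by case: ifP => // _; exact: measurable_itv.
Qed.

Section PrefixCount.
Variables (K : pred nat) (v : nat -> nat).
Hypothesis vN : forall k, (v k < N)%N.

(* The n-digit prefix j has digit [v k] at every k < n selected by [K]. *)
Fixpoint prefix_ok (n : nat) (j : nat) : bool :=
  if n is m.+1 then prefix_ok m (j %/ N) && (K m ==> (j %% N == v m)%N) else true.

Lemma sum_prefix_ok n :
  ((\sum_(0 <= j < N ^ n) prefix_ok n j) * N ^ (\sum_(0 <= k < n) K k) = N ^ n)%N.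
Proof.
elim: n => [|n IHn]; first by rewrite expn0 big_nat1 big_geq.
rewrite {1}expnSr big_nat_mul /=.
have E q : (\sum_(q * N <= j < q.+1 * N)
    (prefix_ok n (j %/ N) && (K n ==> (j %% N == v n))) = prefix_ok n q * (if K n then 1 else N))%N.
  rewrite mulSn addnC -{1}[(q * N)%N]add0n big_addn addKn.
  transitivity (\sum_(0 <= r < N) (prefix_ok n q && (K n ==> (r == v n))))%N.
    apply: eq_big_nat => r /andP[_ rN].
    by rewrite addnC modnMDl modn_small// divnMDl ?card_alphabet_gt0// divn_small// addn0.
  case: (prefix_ok n q) => /=; last by rewrite mul0n big1.
  case: (K n) => /=; last by rewrite sum_nat_const_nat subn0 muln1 mul1n.
  rewrite big_mkord (bigD1 (Ordinal (vN n)))//= eqxx big1 ?mul1n//.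
  by move=> i; rewrite -val_eqE /= => /negPf ->.
rewrite (eq_bigr _ (fun q _ => E q)) -big_distrl /= big_nat_recr//= expnD.
rewrite mulnACA IHn expnSr; congr muln.
by case: (K n); rewrite /= ?expn1 ?mul1n// expn0 muln1.
Qed.

Lemma prefix_okP n x : 0 <= x ->
  prefix_ok n (prefix n x) <-> (forall k, (k < n)%N -> K k -> prefix k.+1 x %% N = v k)%N.
Proof.
move=> x0; elim: n => [|n IHn]; first by split.
rewrite /= prefix_div//; split.
  move=> /andP[/IHn h1 h2] k; rewrite ltnS leq_eqVlt => /orP[/eqP ->|/h1//].
  by move=> Kn; move: h2; rewrite Kn => /eqP.
move=> h; apply/andP; split; first by apply/IHn => k kn; apply: h; exact: ltnW.
by apply/implyP => Kn; apply/eqP/h.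
Qed.

Lemma lebesgue_prefix_itv n j : lebesgue_measure (prefix_itv n j) = ((N%:R ^+ n)^-1)%:E.
Proof.
rewrite /prefix_itv lebesgue_measure_itv /= lte_fin ltr_pM2r ?invr_gt0// ltr_nat ltnSn.
by rewrite -EFinD -mulrBl -natrB// subSnn mul1r.
Qed.

Lemma lebesgue_prefix_ok n :
  lebesgue_measure [set x : R | 0 <= x < 1 /\ prefix_ok n (prefix n x)] =
  ((N%:R ^- (\sum_(0 <= k < n) K k))%R)%:E.
Proof.
pose F j : set R := if prefix_ok n j then prefix_itv n j else set0.
have prefix_itv_ge0 j x : prefix_itv n j x -> 0 <= x.
  by rewrite /prefix_itv /= in_itv /= => /andP[+ _]; apply: le_trans; rewrite divr_ge0// ltW.
have -> : [set x : R | 0 <= x < 1 /\ prefix_ok n (prefix n x)] =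
   \big[setU/set0]_(j < N ^ n) F j.
  rewrite -bigcup_mkord; apply/seteqP; split=> x.
    move=> -[/andP[x0 x1] okx].
    exists (prefix n x) => /=.
      have xN : 0 <= x * N%:R ^+ n by rewrite mulr_ge0// ltW.
      by rewrite /prefix truncn_lt_nat// natrX gtr_pMl.
    by rewrite /F okx; apply/prefixE.
  move=> [j /= jN]; rewrite /F; case: ifPn => // okj xj.
  have x0 := prefix_itv_ge0 _ _ xj.
  split; last by rewrite ((prefixE _ _ x0).2 xj).
  rewrite x0 /=; move: xj; rewrite /prefix_itv /= in_itv /= => /andP[_ /lt_le_trans]; apply.
  by rewrite ler_pdivrMr// mul1r -natrX ler_nat.
have mF j : measurable (F j).
  by rewrite /F; case: ifP => // _; exact: measurable_itv.
have tF : trivIset setT F.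
  move=> i j _ _ [x []]; rewrite /F; do 2 case: ifP => //.
  move=> _ _ xi xj; have x0 := prefix_itv_ge0 _ _ xi.
  by rewrite -((prefixE _ _ x0).2 xi) ((prefixE _ _ x0).2 xj).
rewrite measure_bigsetU//.
rewrite (eq_bigr (fun j : 'I_(N ^ n) => ((prefix_ok n j)%:R / N%:R ^+ n)%:E)); last first.
  move=> j _; rewrite /F; case: ifP => _; rewrite ?measure0 ?mul0r//.
  by rewrite mul1r; exact: lebesgue_prefix_itv.
rewrite sumEFin; congr EFin.
rewrite -mulr_suml -natr_sum; set s := (\sum_(i < _) _)%N.
have sE : (s * N ^ (\sum_(0 <= k < n) K k) = N ^ n)%N.
  by have := sum_prefix_ok n; rewrite (big_mkord predT (fun j => prefix_ok n j : nat)).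
have s0 : s%:R != 0 :> R.
  rewrite pnatr_eq0; apply/eqP => s0; move/esym/eqP: sE.
  by rewrite s0 mul0n expn_eq0 -leqn0 leqNgt card_alphabet_gt0.
by rewrite -!natrX -sE natrM invfM mulrA divff// mul1r.
Qed.

End PrefixCount.

Definition digits_measure : set (config A) -> \bar R :=
  pushforward (mrestr lebesgue_measure (measurable_itv `[(0 : R), 1[)) digits.

HB.instance Definition _ := Measure.copy digits_measure
  (measure_function_pushforward__canonical__measure_function_Measure
     (mrestr lebesgue_measure (measurable_itv `[(0 : R), 1[)) measurable_digits).

Lemma digits_measure_cylinder (s : seq int) (w : int -> A) : uniq s ->
  digits_measure (cylinder s w) = ((N%:R ^- size s)%R)%:E.
Proof.
move=> us.
pose K : pred nat := fun k => k \in map pickle s.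
pose v k := index (w (odflt 0 (unpickle k))) (enum A).
have vN k : (v k < N)%N by rewrite cardE index_mem mem_enum.
pose n := (\max_(z <- s) (pickle z).+1)%N.
have nP z : z \in s -> (pickle z < n)%N.
  by move=> zs; rewrite /n (big_rem z)//= leq_max ltnSn.
have -> : size s = (\sum_(0 <= k < n) K k)%N.
  transitivity (count K (index_iota 0 n)).
    rewrite -size_filter -(size_map (pickle : int -> nat)); apply: perm_size.
    apply: uniq_perm; rewrite ?filter_uniq ?iota_uniq ?(map_inj_uniq (pcan_inj pickleK))//.
    move=> k; rewrite mem_filter mem_index_iota /= /K.
    by apply/idP/andP => [/[dup] ks /mapP[z zs ->]|[]//]; rewrite map_f ?nP.
  by rewrite -sum1_count big_mkcond; apply: eq_bigr => k _; case: (K k).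
rewrite -(lebesgue_prefix_ok K vN).
rewrite /digits_measure /pushforward /mrestr; congr (lebesgue_measure _).
apply/seteqP; split=> x.
  rewrite /= in_itv /= => -[xs x01]; split=> //.
  have x0 : 0 <= x by case/andP: x01.
  apply/prefix_okP => // k kn /mapP[z zs ->]; rewrite /v pickleK /=.
  by apply/digitE; exact: xs.
move=> [x01 okx]; rewrite /= in_itv /=; split=> // z zs.
have x0 : 0 <= x by case/andP: x01.
have /(prefix_okP _ _ _ x0) := okx.
move=> /(_ _ (nP _ zs)); rewrite /K map_f// => /(_ isT) h.
by apply/digitE; rewrite h /v pickleK.
Qed.

Lemma uniform_bernoulli_unique (mu nu : probability (config A) R) :
  is_uniform_bernoulli mu -> is_uniform_bernoulli nu ->
  forall B, measurable B -> mu B = nu B.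
Proof.
move=> mub nub B mB.
pose G : set (set (config A)) := [set C | C = set0 \/ exists s w, C = cylinder s w].
have mG C : G C -> measurable C.
  have mz z x : measurable [set a : config A | a z = x].
    apply: sub_sigma_algebra.
    apply: (@open_comp (config A) (discrete_topology A) (fun a => a z) [set x]).
      by move=> a _; exact: (@proj_continuous int (fun=> discrete_topology A) z a).
    exact: discrete_open.
  move=> [->|[s [w ->]]]; first exact: measurable0.
  elim: s => [|z s IHs].
    by rewrite (_ : cylinder _ _ = setT)//; apply/seteqP.
  rewrite (_ : cylinder _ _ = [set a | a z = w z] `&` cylinder s w).
    exact: measurableI.
  apply/seteqP; split=> a.
    move=> h; split; first by apply: h; rewrite mem_head.
    by move=> y ys; apply: h; rewrite inE ys orbT.
  by move=> [h1 h2] y; rewrite inE => /orP[/eqP ->|/h2].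
have mGE : @measurable _ (config A) = <<s G >>.
  apply/seteqP; split; last by apply: smallest_sub => //; exact: sigma_algebra_measurable.
  move=> C mC.
  have idm : measurable_fun [set: g_sigma_algebraType G] (idfun : _ -> config A).
    apply: config_measurable_fun => z x; apply: sub_sigma_algebra; right.
    exists [:: z], (fun=> x); apply/seteqP; split=> a /=.
      by move=> h y; rewrite inE => /eqP ->.
    by apply; rewrite mem_head.
  by have := idm measurableT C mC; rewrite setTI.
apply: (@measure_unique _ _ _ G (fun=> setT)) => //.
- move=> C D [->|[s [w ->]]]; first by rewrite set0I; left.
  move=> [->|[t [v ->]]]; first by rewrite setI0; left.
  have [wv|/existsNP[z /not_implyP[zs /not_implyP[zt wv]]]] :=
    pselect (forall z, z \in s -> z \in t -> w z = v z).
    right; exists (s ++ t), (fun z => if z \in s then w z else v z).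
    apply/seteqP; split=> a.
      move=> [h1 h2] z; rewrite mem_cat; case: ifPn => [/h1//|_ /=]; exact: h2.
    move=> h; split=> z zs; have := h z; rewrite mem_cat zs ?orbT => /(_ isT) -> //.
    by case: ifP => // zs'; exact: wv.
  left; apply/seteqP; split=> // a [/(_ _ zs) h1 /(_ _ zt) h2].
  by apply: wv; rewrite -h1 -h2.
- by move=> n; right; exists [::], (fun=> point); apply/seteqP.
- by rewrite bigcup_const.
- move=> C [->|[s [w ->]]]; first by rewrite !measure0.
  have -> : cylinder s w = cylinder (undup s) w.
    by apply/seteqP; split=> a h z zs; apply: h; move: zs; rewrite mem_undup.
  by exact: (etrans (mub _ w (undup_uniq s)) (esym (nub _ w (undup_uniq s)))).
- by move=> n; apply: (@le_lt_trans _ _ 1%E); [exact: probability_le1 | exact: ltry].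
Qed.

Lemma exists_uniform_bernoulli :
  exists nu : probability (config A) R, is_uniform_bernoulli nu.
Proof.
have T1 : digits_measure setT = 1%E.
  have := digits_measure_cylinder (fun=> point) (s := [::]) isT.
  by rewrite expr0 invr1 => <-; congr digits_measure; apply/seteqP.
pose P := Measure_isProbability.Build _ _ _ digits_measure T1.
pose nu : probability _ _ := HB.pack digits_measure P.
by exists nu => s w us; exact: digits_measure_cylinder.
Qed.

(* Bundled measures may differ outside the measurable sets, so equality with
   this measure is to be stated on measurable sets. *)
Definition uniform_bernoulli : probability (config A) R :=
  projT1 (cid exists_uniform_bernoulli).

Lemma uniform_bernoulliP : is_uniform_bernoulli uniform_bernoulli.
Proof. exact: projT2 (cid exists_uniform_bernoulli). Qed.

End UniformBernoulli.
Arguments uniform_bernoulli : clear implicits.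

(* Main.v *)
Require Import Defs.
From HB Require Import structures.
From mathcomp Require Import all_boot all_order all_algebra.
From mathcomp Require Import fingroup perm.
From mathcomp Require Import all_classical all_reals all_analysis.
From mathcomp Require Import zify lra.
Import Order.TTheory GRing.Theory Num.Theory.
Import numFieldNormedType.Exports.
Set Implicit Arguments.
Unset Strict Implicit.
Unset Printing Implicit Defensive.
Local Open Scope classical_set_scope.
Local Open Scope ring_scope.

(** Write K for the kernel of Phi, m = l + r, and 1 for the identity.

    A fibre of Phi is a coset x K.  By bipermutativity its points correspond
    bijectively, through restriction, to the words on any fixed block of m
    consecutive positions ([agree_extend], [exists_preimage]).  In particular
    K is finite, so some power S = sigma^n with n >= 1 fixes K pointwise
    ([shift_period]).

    Let k range over K and let mu_k be the image of mu under x |-> x k.  Since S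
    commutes with this translation, mu_k is S-invariant and S-ergodic, just as
    mu is by total ergodicity; hence mu_k and mu are either equal or mutually
    singular ([ergodic_eq_or_singular]).  The k with mu_k = mu form a
    sigma-invariant subgroup J of K, so that J = {1} or J = K.

    If J = {1}, every mu_k with k <> 1 is singular to mu, and discarding
    finitely many null sets leaves a set E of full measure which meets each
    coset of K at most once: Phi is injective on E
    ([trivial_stabilizer_injective]).  This forces zero entropy
    ([partition_entropy_eq0]): almost surely x is a function of Phi x, and this
    function is, up to a small probability of error, computed from finitely many
    coordinates of Phi x.  So the whole orbit x, ..., Phi^n x, seen through a
    fixed block of positions, can be recovered backwards from Phi^n x on that
    block together with a list of corrections which are rarely needed; such a
    description costs o(n) on average.

    Hence J = K.  Averaging over K, a cylinder on m + n consecutive positions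
    then has |A|^-m times the mass of the cylinder of length n which is its image
    under Phi: each fibre that meets the preimage of the latter contains exactly
    one point of the former ([word_cylinder_step]).  Induction on the length
    gives the uniform measure.  The step needs m > 0, which holds because K = J
    is not trivial. *)

(** * Ergodic measures are equal or mutually singular *)

Section Singularity.
Context {d : measure_display} {T : measurableType d} {R : realType}.
Implicit Types mu nu : probability T R.

Definition dominated_on mu nu (P : set T) :=
  forall B, measurable B -> B `<=` P -> (mu B <= nu B)%E.

(** Disjointify the union and compare the pieces one by one. *)
Lemma dominated_on_bigcup mu nu (F : (set T)^nat) :
  (forall n, measurable (F n)) -> (forall n, dominated_on mu nu (F n)) ->
  dominated_on mu nu (\bigcup_n F n).
Proof.
move=> mF dF B mB BF.
have BE : B = \bigcup_n (B `&` seqDU F n).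
  by rewrite -setI_bigcupr -seqDU_bigcup_eq setIidl.
have mBn n : measurable (B `&` seqDU F n).
  by apply: measurableI => //; exact: seqDU_measurable.
have tB : trivIset setT (fun n => B `&` seqDU F n).
  by apply: trivIset_setIl; exact: trivIset_seqDU.
rewrite BE !measure_bigcup//.
apply: lee_nneseries => // n _; apply: dF => //.
by move=> x [_]; exact: subset_seqDU.
Qed.

(** Two probabilities have the same total mass, so a one-sided comparison, applied
    to a set and to its complement, is an equality. *)
Lemma measure_le_eq mu nu :
  dominated_on mu nu setT -> forall B, measurable B -> mu B = nu B.
Proof.
move=> le_mn B mB; apply/eqP; rewrite eq_le le_mn//=.
have := le_mn (~` B) (measurableC mB) (@subsetT _ _).
rewrite !probability_setC//.
rewrite -[mu B]fineK ?fin_num_measure// -[nu B]fineK ?fin_num_measure//.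
by rewrite -!EFinB !lee_fin lerD2l lerN2.
Qed.

Lemma exists_hahn_set mu nu : exists P,
  [/\ measurable P, dominated_on mu nu P & dominated_on nu mu (~` P)].
Proof.
pose delta := cadd (charge_of_finite_measure nu)
  (copp (charge_of_finite_measure mu)).
have [P [N [[mP posP] [mN negN] PN PN0]]] := Hahn_decomposition delta.
exists P; split=> // B mB BP.
  have : (0 <= nu B - mu B)%E by exact: posP.
  by rewrite sube_ge0// fin_num_measure.
have BN : B `<=` N.
  by move=> x /BP Px; have [] : (P `|` N) x by rewrite PN.
have : (nu B - mu B <= 0)%E by exact: negN.
by rewrite sube_le0.
Qed.

Variables (S S' : T -> T).
Hypotheses (SK : cancel S S') (S'K : cancel S' S).
Hypotheses (mS : measurable_fun setT S) (mS' : measurable_fun setT S').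

Let mpre (f : T -> T) : measurable_fun setT f ->
  forall B, measurable B -> measurable (f @^-1` B).
Proof. by move=> mf B mB; rewrite -[_ @^-1` _]setTI; exact: mf. Qed.

(** Invertibility of S turns a subset of the preimage of P into the preimage of a
    subset of P. *)
Lemma dominated_on_preimage mu nu P :
  measure_invariant mu S -> measure_invariant nu S ->
  dominated_on mu nu P -> dominated_on mu nu (S @^-1` P).
Proof.
move=> Imu Inu dP B mB BP.
have <- : S @^-1` (S' @^-1` B) = B by apply/seteqP; split=> x /=; rewrite SK.
have mB' : measurable (S' @^-1` B) by exact: mpre.
rewrite Imu// Inu//; apply: dP => // x /= /BP /=; by rewrite S'K.
Qed.

(** A Hahn set P of the pair (nu, mu) can be made strictly S-invariant: the limit
    superior Q of its preimages under the iterates of S is again a Hahn set,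
    because each preimage is one and both halves of the Hahn property pass to
    countable unions.  Ergodicity gives Q mass 0 or 1 for each measure.  If the
    two masses agree, one measure dominates the other, so they are equal;
    otherwise Q separates them. *)
Lemma ergodic_eq_or_singular mu nu :
  measure_invariant mu S -> measure_invariant nu S ->
  ergodic mu S -> ergodic nu S ->
  (forall B, measurable B -> mu B = nu B) \/
  exists P, [/\ measurable P, mu P = 1%E & nu P = 0%E].
Proof.
move=> Imu Inu Emu Enu.
have [P [mP dP dN]] := exists_hahn_set nu mu.
pose F n := iter n S @^-1` P.
have FS n : F n.+1 = S @^-1` F n by apply/seteqP; split=> x; rewrite /F /= -iterSr.
have mF n : measurable (F n).
  by elim: n => [//|n IHn]; rewrite FS; exact: mpre.
have dF n : dominated_on nu mu (F n).
  by elim: n => [//|n IHn]; rewrite FS; exact: dominated_on_preimage.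
have dFC n : dominated_on mu nu (~` F n).
  by elim: n => [//|n IHn]; rewrite FS preimage_setC; exact: dominated_on_preimage.
pose Q := lim_sup_set F.
have mQ : measurable Q.
  by apply: bigcapT_measurable => n; apply: bigcup_measurable => k _.
have SQ : S @^-1` Q = Q.
  apply/seteqP; split=> x Qx n _.
    have [k nk Fk] := Qx n I; exists k.+1; first exact: leqW.
    by rewrite FS.
  have [[//|k] nk Fk] := Qx n.+1 I; exists k => //.
  by rewrite FS in Fk.
have dQ : dominated_on nu mu Q.
  move=> B mB BQ; apply: (dominated_on_bigcup mF dF mB) => x /BQ /(_ 0%N I).
  by move=> [k _ Fk]; exists k.
have dQC : dominated_on mu nu (~` Q).
  move=> B mB BQ; apply: (dominated_on_bigcup _ dFC mB).
    by move=> n; exact: measurableC.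
  move=> x /BQ; rewrite /Q /lim_sup_set setC_bigcap => -[n _].
  by rewrite setC_bigcup => /(_ n) Fn; exists n => //; apply: Fn => /=.
have splitQ B : B = (B `&` Q) `|` (B `&` ~` Q).
  by rewrite -setIUr setUv setIT.
have addQ (la : probability T R) B : measurable B ->
    la B = (la (B `&` Q) + la (B `&` ~` Q))%E.
  move=> mB; rewrite {1}(splitQ B) measureU//.
  - exact: measurableI.
  - by apply: measurableI => //; exact: measurableC.
  - by rewrite setIACA setICr setI0.
have nullQ (la : probability T R) A B : measurable A -> measurable B ->
    la A = 0%E -> la (B `&` A) = 0%E.
  move=> mA mB lA; apply: subset_measure0 lA => //.
  exact: measurableI.
have mQC : measurable (~` Q) by exact: measurableC.
have null_setC (la : probability T R) : la Q = 1%E -> la (~` Q) = 0%E.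
  by move=> lQ; rewrite probability_setC// lQ subee.
case: (Emu _ mQ SQ) => muQ; case: (Enu _ mQ SQ) => nuQ.
- left; apply: measure_le_eq => B mB _.
  rewrite (addQ mu)// (addQ nu)//; rewrite !(nullQ _ Q)// !add0e.
  by apply: dQC; [exact: measurableI | exact: subIsetr].
- have : (nu Q <= mu Q)%E by exact: dQ.
  by rewrite muQ nuQ lee_fin ler10.
- by right; exists Q.
- left=> B mB; apply/esym; move: B mB; apply: measure_le_eq => B mB _.
  rewrite (addQ mu)// (addQ nu)//; rewrite !(nullQ _ (~` Q))// ?null_setC// !adde0.
  by apply: dQ; [exact: measurableI | exact: subIsetr].
Qed.

End Singularity.

(** * Shannon entropy of finite-valued functions *)

Section FiniteValued.
Context {d : measure_display} {T : measurableType d} {R : realType}.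
Variable mu : probability T R.

Definition measurable_fibres (I : finType) (X : T -> I) :=
  forall i, measurable (X @^-1` [set i]).

Definition law (I : finType) (X : T -> I) i : R := fine (mu (X @^-1` [set i])).

Definition shannon (I : finType) (X : T -> I) : R :=
  - \sum_i law X i * ln (law X i).

Lemma measurable_fibres_preimage (I : finType) (X : T -> I) (B : set I) :
  measurable_fibres X -> measurable (X @^-1` B).
Proof.
move=> mX; have -> : X @^-1` B = \bigcup_(i in B) X @^-1` [set i].
  by apply/seteqP; split=> [x Bx|x [i Bi /= ->]//]; exists (X x).
by apply: fin_bigcup_measurable => // *; exact: finite_finset.
Qed.

Lemma measurable_fibres_comp (I J : finType) (X : T -> I) (f : I -> J) :
  measurable_fibres X -> measurable_fibres (fun x => f (X x)).
Proof. by move=> mX j; apply: (measurable_fibres_preimage [set i | f i = j]). Qed.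

Lemma measurable_fibres_pair (I J : finType) (X : T -> I) (Y : T -> J) :
  measurable_fibres X -> measurable_fibres Y ->
  measurable_fibres (fun x => (X x, Y x)).
Proof.
move=> mX mY [i j].
have -> : (fun x => (X x, Y x)) @^-1` [set (i, j)] =
    (X @^-1` [set i]) `&` (Y @^-1` [set j]).
  by apply/seteqP; split=> x /=; [case=> -> -> | case=> -> ->].
exact: measurableI.
Qed.

Lemma measurable_fibres_ffun (I J : finType) (X : I -> T -> J) :
  (forall i, measurable_fibres (X i)) ->
  measurable_fibres (fun x => [ffun i => X i x]).
Proof.
move=> mX w.
have -> : (fun x => [ffun i => X i x]) @^-1` [set w] =
    \bigcap_(i in setT) (X i @^-1` [set w i]).
  apply/seteqP; split=> x /=; first by move=> <- i _ /=; rewrite ffunE.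
  by move=> Xw; apply/ffunP => i; rewrite ffunE; exact: Xw.
by apply: fin_bigcap_measurable => [|i _]; [exact: finite_finset | exact: mX].
Qed.

Lemma law_ge0 (I : finType) (X : T -> I) i : 0 <= law X i.
Proof. exact: fine_ge0. Qed.

Lemma law_preimage (I : finType) (X : T -> I) (P : pred I) :
  measurable_fibres X ->
  fine (mu (X @^-1` [set i | P i])) = \sum_(i | P i) law X i.
Proof.
move=> mX; have -> : X @^-1` [set i | P i] =
    \bigcup_(i in [set` enum P]) X @^-1` [set i].
  apply/seteqP; split=> [x /= Px|x [i /= + ->]].
    by exists (X x) => //=; rewrite mem_enum.
  by rewrite mem_enum.
have tX : trivIset [set` enum P] (fun i => X @^-1` [set i]).
  by move=> i j _ _ [x [/= -> ->]].
rewrite (measure_fin_bigcup _ _ tX)//.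
rewrite -fsbig_seq ?enum_uniq// big_enum_cond /=.
rewrite -sum_fine; last by move=> i _; rewrite fin_num_measure.
by apply: eq_bigl => i; rewrite andbT.
Qed.

Lemma sum_law (I : finType) (X : T -> I) :
  measurable_fibres X -> \sum_i law X i = 1.
Proof.
move=> mX; rewrite -(law_preimage xpredT)// (_ : _ @^-1` _ = setT).
  by rewrite probability_setT.
by apply/seteqP.
Qed.

Lemma law_comp (I J : finType) (X : T -> I) (f : I -> J) j :
  measurable_fibres X ->
  law (fun x => f (X x)) j = \sum_(i | f i == j) law X i.
Proof.
move=> mX; rewrite -law_preimage//; congr (fine (mu _)).
by apply/seteqP; split=> x /= /eqP.
Qed.

Lemma mean_comp (I J : finType) (X : T -> I) (f : I -> J) (g : J -> R) :
  measurable_fibres X ->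
  \sum_i law X i * g (f i) = \sum_j law (fun x => f (X x)) j * g j.
Proof.
move=> mX; rewrite (partition_big f xpredT)//=; apply: eq_bigr => j _.
rewrite law_comp// mulr_suml; apply: eq_bigr => i /eqP -> //.
Qed.

(** The inequality of Gibbs for a code whose lengths c satisfy the inequality of
    Kraft: termwise it is ln t <= t - 1 at t = exp (- c i) / law X i. *)
Lemma gibbs_inequality (I : finType) (X : T -> I) (c : I -> R) :
  measurable_fibres X -> \sum_i expR (- c i) <= 1 ->
  shannon X <= \sum_i law X i * c i.
Proof.
move=> mX kraft.
have le_term i : - (law X i * ln (law X i)) <=
    law X i * c i + (expR (- c i) - law X i).
  have [->|p0] := eqVneq (law X i) 0.
    by rewrite !mul0r oppr0 addr0 add0r expR_ge0.
  have {}p0 : 0 < law X i by rewrite lt_neqAle eq_sym p0 law_ge0.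
  have lnE : ln (expR (- c i) / law X i) = - c i - ln (law X i).
    by rewrite ln_div ?posrE ?expR_gt0// expRK.
  have : ln (expR (- c i) / law X i) <= expR (- c i) / law X i - 1.
    rewrite -[X in ln X](subrKC 1); apply: le_ln1Dx.
    by rewrite ltrBrDl subrr divr_gt0 ?expR_gt0.
  rewrite lnE -(ler_pM2l p0) !mulrBr mulrCA divff ?gt_eqF//; lra.
rewrite /shannon -sumrN; apply: le_trans (ler_sum _ (fun i _ => le_term i)) _.
rewrite big_split /= sumrB sum_law// gerDl; lra.
Qed.

(** The fibres of X are unions of fibres of Z, and refining a partition cannot
    decrease entropy. *)
Lemma shannon_factor (I J : finType) (Z : T -> J) (X : T -> I) :
  measurable_fibres Z -> (forall x x', Z x = Z x' -> X x = X x') ->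
  shannon X <= shannon Z.
Proof.
move=> mZ ZX.
pose f j := X (xget point (Z @^-1` [set j])).
have fZ : X = fun x => f (Z x).
  apply/funext => x; rewrite /f; apply: ZX.
  by case: xgetP => [y _ <-//|/(_ x)/=].
have -> : shannon X = - \sum_j law Z j * ln (law X (f j)).
  by rewrite (mean_comp f (fun i => ln (law X i)))// -fZ.
rewrite lerN2.
apply: ler_sum => j _.
have [->|p0] := eqVneq (law Z j) 0; first by rewrite !mul0r.
have {}p0 : 0 < law Z j by rewrite lt_neqAle eq_sym p0 law_ge0.
have le_p : law Z j <= law X (f j).
  rewrite fZ law_comp// (bigD1 j)//= lerDl sumr_ge0// => *; exact: law_ge0.
by rewrite ler_wpM2l ?law_ge0// ler_ln ?posrE// (lt_le_trans p0).
Qed.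

Variables (F : T -> T).
Hypotheses (mF : measurable_fun setT F) (muF : measure_invariant mu F).

Lemma preimage_iter_measurable n B :
  measurable B -> measurable (iter n F @^-1` B).
Proof.
elim: n B => [//|n IHn] B mB.
have -> : iter n.+1 F @^-1` B = iter n F @^-1` (F @^-1` B) by [].
by apply: IHn; rewrite -[_ @^-1` _]setTI; exact: mF.
Qed.

Lemma measure_invariant_iter n : measure_invariant mu (iter n F).
Proof.
elim: n => [//|n IHn] B mB.
have -> : iter n.+1 F @^-1` B = iter n F @^-1` (F @^-1` B) by [].
rewrite IHn ?muF//; exact: (preimage_iter_measurable 1).
Qed.

(** Cost of a description made of one value of Y and of the values of e along n
    steps of a stationary orbit.  Y is coded with equal lengths and each value u of e
    with length c u; the total length is a Kraft code for the pair, and by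
    invariance each step has the same mean length. *)
Lemma shannon_stationary_code (I J E : finType) (X : T -> I) (Y : T -> J)
    (e : T -> E) (c : E -> R) (n : nat) :
  measurable_fibres Y -> measurable_fibres e ->
  (forall x x', Y x = Y x' ->
     (forall i, (i < n)%N -> e (iter i F x) = e (iter i F x')) -> X x = X x') ->
  \sum_u expR (- c u) <= 1 ->
  shannon X <= ln #|J|%:R + n%:R * \sum_u law e u * c u.
Proof.
move=> mY me YeX kraft.
pose W x := [ffun i : 'I_n => e (iter i F x)].
have mW : measurable_fibres W.
  apply: measurable_fibres_ffun => i u.
  exact: (preimage_iter_measurable i (me u)).
pose Z x := (Y x, W x).
have mZ : measurable_fibres Z by exact: measurable_fibres_pair.
have J0R : 0 < #|J|%:R :> R.
  by rewrite ltr0n; apply/card_gt0P; exists (Y point).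
pose cZ (z : J * {ffun 'I_n -> E}) : R := ln #|J|%:R + \sum_i c (z.2 i).
have kraftZ : \sum_z expR (- cZ z) <= 1.
  rewrite -(pair_bigA _ (fun i j => expR (- cZ (i, j)))) /=.
  under eq_bigr do under eq_bigr do
    rewrite /cZ /= opprD expRD -sumrN expR_sum expRN lnK ?posrE//.
  rewrite sumr_const -mulr_sumr -mulrnAl -[_ *+ #|_|]mulr_natr mulVf ?gt_eqF//.
  rewrite mul1r -(bigA_distr_bigA (fun _ u => expR (- c u))) /= prodr_const.
  by rewrite exprn_ile1// sumr_ge0// => u _; exact: expR_ge0.
apply: (@le_trans _ _ (shannon Z)).
  apply: shannon_factor => // x x' [Yx Wx]; apply: YeX => // i ltin.
  by move/ffunP/(_ (Ordinal ltin)): Wx; rewrite !ffunE.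
apply: le_trans (gibbs_inequality mZ kraftZ) _.
rewrite /cZ; under eq_bigr do rewrite mulrDr.
rewrite big_split /= -mulr_suml sum_law// mul1r lerD2l.
under eq_bigr do rewrite mulr_sumr.
rewrite exchange_big /= [leRHS]mulr_natl -[X in _ *+ X]card_ord -sumr_const.
apply: ler_sum => i _.
rewrite (mean_comp (fun z : J * {ffun 'I_n -> E} => z.2 i) c)//.
have -> // : law (fun x => (Z x).2 i) = law e.
apply/funext => u; rewrite /law; congr fine.
rewrite -(measure_invariant_iter i (me u)); congr (mu _).
by apply/seteqP; split=> x /=; rewrite ffunE.
Qed.

End FiniteValued.

(** * Cylinders and approximation of Borel sets *)

Section Cylinders.
Context {A : pfinType}.
Implicit Types (a b : config A) (z u v : int).

Definition agree u v a b := forall z, u <= z < v -> a z = b z.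

(** f depends only on the coordinates in [-N, N].  Being locally constant, such an f
    stands for a clopen set when it is boolean. *)
Definition determined (N : nat) (U : Type) (f : config A -> U) :=
  forall a b, agree (- N%:Z) N.+1%:Z a b -> f a = f b.

Lemma agree_sub u v u' v' a b :
  u <= u' -> v' <= v -> agree u v a b -> agree u' v' a b.
Proof. by move=> uu vv ab z zuv; apply: ab; lia. Qed.

Lemma determined_le M N (U : Type) (f : config A -> U) :
  (M <= N)%N -> determined M f -> determined N f.
Proof. by move=> MN df a b ab; apply: df; apply: agree_sub ab; lia. Qed.

Lemma open_coordinate z (x : A) : open [set a : config A | a z = x].
Proof.
apply: (@open_comp (config A) (discrete_topology A) (fun a => a z) [set x]).
  by move=> a _; exact: (@proj_continuous int (fun=> discrete_topology A) z a).
exact: discrete_open.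
Qed.

Lemma open_cylinder (s : seq int) (w : int -> A) : open (cylinder s w).
Proof.
elim: s => [|z s IHs].
  by rewrite (_ : cylinder _ _ = setT); [exact: openT | apply/seteqP].
rewrite (_ : cylinder _ _ = [set a | a z = w z] `&` cylinder s w).
  by apply: openI => //; exact: open_coordinate.
apply/seteqP; split=> a.
  move=> h; split; first by apply: h; rewrite mem_head.
  by move=> y ys; apply: h; rewrite inE ys orbT.
by move=> [h1 h2] y; rewrite inE => /orP[/eqP ->|/h2].
Qed.

Lemma measurable_config_open (B : set (config A)) : open B -> measurable B.
Proof. exact: sub_sigma_algebra. Qed.

Lemma determined_measurable N (U : Type) (f : config A -> U) (u : U) :
  determined N f -> measurable (f @^-1` [set u]).
Proof.
move=> df; apply: measurable_config_open.
pose s : seq int := [seq i%:Z - N%:Z | i <- iota 0 N.+1.*2].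
have -> : f @^-1` [set u] =
    \bigcup_(a in f @^-1` [set u]) cylinder s a.
  apply/seteqP; split=> [a fa|b [a <- ab]]; first by exists a.
  apply: df => z zN; apply: ab; apply/mapP; exists `|(z + N%:Z)%R|%N; last by lia.
  by rewrite mem_iota; lia.
by apply: bigcup_open => a _; exact: open_cylinder.
Qed.

Lemma continuous_measurable_config (f : config A -> config A) :
  continuous f -> measurable_fun setT f.
Proof.
move=> cf; apply: (@measurability _ _ _ _ setT f (@open (config A))) => //.
move=> _ [U oU <-]; rewrite setTI; apply: measurable_config_open.
by apply: open_comp => // a _; exact: cf.
Qed.

Lemma measurable_preimage (f : config A -> config A) B :
  measurable_fun setT f -> measurable B -> measurable (f @^-1` B).
Proof. by move=> mf mB; rewrite -[_ @^-1` _]setTI; exact: mf. Qed.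

(** Induction over the Borel sets, generated by the one-coordinate cylinders. *)
Lemma measurable_config_ind (P : set (set (config A))) :
  P set0 -> (forall B, P B -> P (~` B)) ->
  (forall F : (set (config A))^nat, (forall n, P (F n)) -> P (\bigcup_n F n)) ->
  (forall z (x : A), P [set a | a z = x]) ->
  forall B, measurable B -> P B.
Proof.
move=> P0 PC PU Pz B mB.
pose G : set (set (config A)) := [set C | exists z x, C = [set a | a z = x]].
have idm : measurable_fun [set: g_sigma_algebraType G] (idfun : _ -> config A).
  by apply: config_measurable_fun => z x; apply: sub_sigma_algebra; exists z, x.
have := idm measurableT B mB; rewrite setTI => GB.
have: <<s G >> `<=` P; last by apply.
apply: smallest_sub => [|_ [z [x ->]]//].
by split=> // C PCC; rewrite setTD; exact: PC.
Qed.

Section Approximation.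
Context {R : realType}.
Variable mu : probability (config A) R.

(** The symmetric difference of B and C; C is boolean so that it can be evaluated
    when decoding. *)
Definition mismatch (B : set (config A)) (C : pred (config A)) :=
  [set a | B a /\ ~~ C a \/ ~ B a /\ C a].

Lemma mismatch_out B C a : ~ mismatch B C a -> B a <-> C a.
Proof.
move=> nBC; split=> [Ba|Ca].
  by apply/negPn/negP => nC; apply: nBC; left.
by apply: contrapT => nB; apply: nBC; right.
Qed.

Lemma measurable_mismatch B C N : measurable B -> determined N C ->
  measurable (mismatch B C).
Proof.
move=> mB dC; have mC : measurable [set a | C a].
  exact: (determined_measurable true dC).
have -> : mismatch B C = (B `\` [set a | C a]) `|` ([set a | C a] `\` B).
  apply/seteqP; split=> a /=.
    by move=> [[Ba /negP]|[]]; [left|right].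
  by move=> [[Ba /negP]|[]]; [left|right].
by apply: measurableU; apply: measurableD.
Qed.

Definition approximable (B : set (config A)) :=
  measurable B /\ forall eps : R, 0 < eps -> exists N C,
    determined N C /\ (mu (mismatch B C) < eps%:E)%E.

Lemma approximableU B B' :
  approximable B -> approximable B' -> approximable (B `|` B').
Proof.
move=> [mB aB] [mB' aB']; split=> [|eps eps0]; first exact: measurableU.
have eps20 : 0 < eps / 2 by rewrite divr_gt0.
have [N [C [dC C_lt]]] := aB _ eps20.
have [N' [C' [dC' C_lt']]] := aB' _ eps20.
exists (maxn N N'), (fun a => C a || C' a).
have dCC : determined (maxn N N') (fun a => C a || C' a).
  move=> a b ab.
  by rewrite (determined_le (leq_maxl N N') dC ab) (determined_le (leq_maxr N N') dC' ab).
split=> //; rewrite [eps]splitr EFinD.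
apply: le_lt_trans (lteD C_lt C_lt').
have mm := measurable_mismatch mB dC; have mm' := measurable_mismatch mB' dC'.
apply: le_trans (measureU2 _ mm mm').
apply: le_measure; rewrite ?inE.
- by apply: measurable_mismatch dCC; exact: measurableU.
- exact: measurableU.
move=> a /= [[BB /norP[nC nC']]|[/not_orP[nB nB'] /orP[Ca|Ca']]].
- by case: BB => ?; [left|right]; left.
- by left; right.
- by right; right.
Qed.

(** The approximable sets form a sigma-algebra containing the cylinders: a countable
    union is approximated by a finite one, up to a small measure. *)
Lemma measurable_approximable B : measurable B -> approximable B.
Proof.
apply: measurable_config_ind.
- split=> // eps eps0; exists 0%N, xpred0; split=> //.
  rewrite (_ : mismatch _ _ = set0) ?measure0 ?lte_fin//.
  by apply/seteqP; split=> // a [[]|[]].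
- move=> C [mC aC]; split=> [|eps /aC[N [D [dD D_lt]]]]; first exact: measurableC.
  exists N, (fun a => ~~ D a); split; first by move=> a b /dD ->.
  rewrite (_ : mismatch _ _ = mismatch C D)//.
  apply/seteqP; split=> a; rewrite /mismatch /= negbK.
    by move=> [|[/contrapT]]; [right|left].
  by move=> [[Ca nD]|]; [right; split=> // /(_ Ca)|left].
- move=> F aF; have mF n : measurable (F n) by case: (aF n).
  have mU : measurable (\bigcup_n F n) by exact: bigcup_measurable.
  split=> // eps eps0; have eps20 : 0 < eps / 2 by rewrite divr_gt0.
  pose V n := \big[setU/set0]_(i < n) F i.
  have aV n : approximable (V n).
    elim: n => [|n IHn]; rewrite /V ?big_ord0 ?big_ord_recr /=.
      split=> // e e0; exists 0%N, xpred0; split=> //.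
      rewrite (_ : mismatch _ _ = set0) ?measure0 ?lte_fin//.
      by apply/seteqP; split=> // a [[]|[]].
    exact: approximableU IHn (aF n).
  have mV n : measurable (V n) by case: (aV n).
  (* These tails decrease to the empty set, so their measure tends to 0. *)
  pose D n := (\bigcup_n F n) `\` V n.
  have mD n : measurable (D n) by exact: measurableD.
  have D0 : \bigcap_n D n = set0.
    apply/seteqP; split=> // a Da; have [[n _ Fn] _] := Da 0%N I.
    have [_] := Da n.+1 I; apply; rewrite /V -bigcup_mkord; by exists n => /=.
  have [n Dn] : exists n, (mu (D n) < (eps / 2)%:E)%E.
    have : (mu \o D) x @[x --> \oo] --> mu (\bigcap_n D n).
      apply: nonincreasing_cvg_mu => //.
      - by rewrite (le_lt_trans (probability_le1 _ _)) ?ltry.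
      - by rewrite D0.
      - move=> n p np; apply/subsetPset; apply: setDS.
        exact: subset_bigsetU.
    rewrite D0 measure0 => /(_ [set x | x < (eps / 2)%:E]%E)[|n _ /(_ n)/= nP].
      by apply: open_ereal_lt'; rewrite lte_fin.
    by exists n; exact: nP.
  have [_ /(_ _ eps20)[N [C [dC C_lt]]]] := aV n.
  exists N, C; split=> //.
  rewrite [eps]splitr EFinD; apply: le_lt_trans (lteD Dn C_lt).
  have mm := measurable_mismatch (mV n) dC.
  apply: le_trans (measureU2 _ (mD n) mm).
  apply: le_measure; rewrite ?inE.
  + exact: measurable_mismatch dC.
  + exact: measurableU.
  have VF : V n `<=` \bigcup_n F n by rewrite /V -bigcup_mkord => a [k _ Fk]; exists k.
  move=> a [[Fa nC]|[nF Ca]].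
    by have [Va|nV] := pselect (V n a); [right; left|left].
  by right; right; split=> // /VF.
- move=> z x; split; first exact: measurable_config_open (open_coordinate z x).
  move=> eps eps0; exists `|z|%N, (fun a => a z == x); split.
    by move=> a b ab; congr (_ == _); apply: ab; lia.
  rewrite (_ : mismatch _ _ = set0) ?measure0 ?lte_fin//.
  apply/seteqP; split=> // a; rewrite /mismatch /= => -[[->]|[ax /eqP//]].
  by rewrite eqxx.
Qed.

Lemma approximation (I : finType) (B : I -> set (config A)) (eps : R) :
  0 < eps -> (forall i, measurable (B i)) ->
  exists N (C : I -> pred (config A)), (forall i, determined N (C i)) /\
    (mu (\bigcup_i mismatch (B i) (C i)) < eps%:E)%E.
Proof.
move=> eps0 mB.
have eI0 : 0 < eps / #|I|.+1%:R by rewrite divr_gt0.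
have /choice[N0 /choice[C dC]] : forall i, exists N C,
    determined N C /\ (mu (mismatch (B i) C) < (eps / #|I|.+1%:R)%:E)%E.
  by move=> i; have [_] := measurable_approximable (mB i); apply.
pose N := (\max_i N0 i)%N.
have dNC i : determined N (C i).
  by have [di _] := dC i; apply: determined_le di; exact: leq_bigmax.
exists N, C; split=> //.
have mM i : measurable (mismatch (B i) (C i)) by exact: measurable_mismatch.
apply: (@le_lt_trans _ _ (\sum_(i <- enum I) mu (mismatch (B i) (C i)))%E).
  rewrite fsbig_seq ?enum_uniq//; apply: content_sub_fsum => //.
    by apply: fin_bigcup_measurable => //; exact: finite_finset.
  by move=> a [i _ Ma]; exists i => //=; rewrite mem_enum.
apply: (@le_lt_trans _ _ (\sum_(i <- enum I) (eps / #|I|.+1%:R)%:E)%E).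
  by apply: lee_sum => i _; have [_ /ltW] := dC i.
rewrite sumEFin lte_fin big_enum sumr_const -[ltLHS]mulr_natr -mulrA gtr_pMr//.
by rewrite mulrC ltr_pdivrMr// mul1r ltr_nat.
Qed.
End Approximation.
End Cylinders.

(** * Fibres of a bipermutative cellular automaton *)

Section BipermutativeRule.
Context {A : pfinType} (Phi : config A -> config A) (l r : nat).
Variable phi : (l + r).+1.-tuple A -> A.
Hypothesis Phi_phi : has_local_rule Phi phi.
Hypothesis phiL : left_permutative_rule phi.
Hypothesis phiR : right_permutative_rule phi.
Implicit Types (a b x y : config A) (c u v z : int).
Local Notation m := (l + r)%N.

Definition block u a : m.-tuple A := [tuple a (u + i%:Z) | i < m].

Lemma tnth_block u a i : tnth (block u a) i = a (u + i%:Z).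
Proof. exact: tnth_mktuple. Qed.

Lemma nth_block (x0 : A) u a i : (i < m)%N -> nth x0 (block u a) i = a (u + i%:Z).
Proof. by move=> im; rewrite -[i]/(val (Ordinal im)) -tnth_nth tnth_block. Qed.

Lemma eq_block u a b : agree u (u + m%:Z) a b -> block u a = block u b.
Proof. by move=> ab; apply: eq_mktuple => i; apply: ab; have := ltn_ord i; lia. Qed.

Lemma block_agree u a b : block u a = block u b -> agree u (u + m%:Z) a b.
Proof.
move=> ab z zu; have zm : (`|(z - u)%R| < m)%N by lia.
have /(congr1 (fun t => tnth t (Ordinal zm))) := ab.
by rewrite !tnth_block /= (_ : u + _ = z)//; lia.
Qed.

Lemma rule_rightE a u :
  Phi a (u + l%:Z) = phi [tuple of rcons (block u a) (a (u + m%:Z))].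
Proof.
rewrite Phi_phi; congr phi; apply: eq_from_tnth => i.
rewrite tnth_mktuple (tnth_nth (a 0)) /= nth_rcons (size_tuple (block u a)) addrK.
case: ltnP => im; first by rewrite nth_block.
have -> : (i : nat) = m by have := ltn_ord i; lia.
by rewrite eqxx.
Qed.

Lemma rule_leftE a u :
  Phi a (u + l%:Z) = phi [tuple of a u :: block (u + 1) a].
Proof.
rewrite Phi_phi; congr phi; apply: eq_from_tnth => i.
rewrite tnth_mktuple (tnth_nth (a 0)) /= addrK.
case: i => -[|i] im /=; first by rewrite addr0.
rewrite ltnS in im.
by rewrite nth_block//; congr a; lia.
Qed.

Lemma agree_image u v a b :
  agree u v a b -> agree (u + l%:Z) (v - r%:Z) (Phi a) (Phi b).
Proof.
move=> ab z zuv; rewrite !Phi_phi; congr phi; apply: eq_mktuple => i.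
by apply: ab; have := ltn_ord i; lia.
Qed.

Lemma agree_next u a b : agree u (u + m%:Z) a b ->
  Phi a (u + l%:Z) = Phi b (u + l%:Z) -> a (u + m%:Z) = b (u + m%:Z).
Proof.
move=> /eq_block ab; rewrite !rule_rightE ab; exact: (bij_inj (phiR _)).
Qed.

Lemma agree_prev u a b : agree (u + 1) (u + 1 + m%:Z) a b ->
  Phi a (u + l%:Z) = Phi b (u + l%:Z) -> a u = b u.
Proof.
move=> /eq_block ab; rewrite !rule_leftE ab; exact: (bij_inj (phiL _)).
Qed.

(** Permutativity lets one deduce the next coordinate, on either side, from m known
    consecutive ones and the image; so agreement on a block of length m spreads as
    far as the images agree. *)
Lemma agree_extend c u v a b : u <= c -> c + m%:Z <= v ->
  agree c (c + m%:Z) a b -> agree (u + l%:Z) (v - r%:Z) (Phi a) (Phi b) ->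
  agree u v a b.
Proof.
move=> uc cv ab Pab.
have right n : c + m%:Z + n%:Z <= v -> agree c (c + m%:Z + n%:Z) a b.
  elim: n => [|n IHn] nv; first by rewrite addr0.
  have {}IHn : agree c (c + m%:Z + n%:Z) a b by apply: IHn; lia.
  move=> z zn; have [zlt|zge] := ltP z (c + m%:Z + n%:Z); first by apply: IHn; lia.
  have -> : z = c + n%:Z + m%:Z by lia.
  apply: agree_next; first by apply: agree_sub IHn; lia.
  by apply: Pab; lia.
have left n : u <= c - n%:Z -> agree (c - n%:Z) v a b.
  elim: n => [|n IHn] un.
    by have := right `|(v - c - m%:Z)%R|%N; rewrite subr0 (_ : _ + _ = v); [apply|]; lia.
  have {}IHn : agree (c - n%:Z) v a b by apply: IHn; lia.
  move=> z zn; have [zlt|zge] := ltP z (c - n%:Z); last by apply: IHn; lia.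
  apply: agree_prev; first by apply: agree_sub IHn; lia.
  by apply: Pab; lia.
by have := left `|(c - u)%R|%N; rewrite (_ : c - _ = u); [apply|]; lia.
Qed.

(** One more coordinate on each side is chosen so that the rule takes the value
    prescribed by y there. *)
Lemma exists_preimage_step y c (n : nat) x :
  agree (c + l%:Z - n%:Z) (c + l%:Z + n%:Z) (Phi x) y ->
  exists x', agree (c - n%:Z) (c + m%:Z + n%:Z) x x' /\
    agree (c + l%:Z - n.+1%:Z) (c + l%:Z + n.+1%:Z) (Phi x') y.
Proof.
move=> xy.
have [fR _ fRK] := phiR (block (c + n%:Z) x).
have [fL _ fLK] := phiL (block (c - n%:Z) x).
(* The two new positions are distinct since m + 2 n + 1 > 0. *)
pose x' : config A := fun z =>
  if z == c + m%:Z + n%:Z then fR (y (c + n%:Z + l%:Z)) else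
  if z == c - n%:Z - 1 then fL (y (c - n%:Z - 1 + l%:Z)) else x z.
have xx' : agree (c - n%:Z) (c + m%:Z + n%:Z) x x'.
  by move=> z zn; rewrite /x' !ifF//; lia.
exists x'; split=> // z zn.
have [->|zR] := eqVneq z (c + n%:Z + l%:Z).
  rewrite rule_rightE -(@eq_block _ x); last by apply: agree_sub xx'; lia.
  rewrite (_ : x' (c + n%:Z + m%:Z) = fR (y (c + n%:Z + l%:Z))); first exact: fRK.
  by rewrite /x' ifT//; lia.
have [->|zL] := eqVneq z (c - n%:Z - 1 + l%:Z).
  rewrite rule_leftE subrK -(@eq_block _ x); last by apply: agree_sub xx'; lia.
  rewrite (_ : x' (c - n%:Z - 1) = fL (y (c - n%:Z - 1 + l%:Z))); first exact: fLK.
  by rewrite /x' ifF ?eqxx//; lia.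
rewrite -(agree_image xx'); last by lia.
by apply: xy; lia.
Qed.

(** Starting from the block of a at c, the coordinates outside it are chosen one by
    one in both directions so that the image becomes y; each coordinate is
    eventually constant along this construction. *)
Lemma exists_preimage y a c : exists x, Phi x = y /\ agree c (c + m%:Z) x a.
Proof.
have /choice[f fP] : forall p : nat * config A, exists x',
    agree (c + l%:Z - p.1%:Z) (c + l%:Z + p.1%:Z) (Phi p.2) y ->
    agree (c - p.1%:Z) (c + m%:Z + p.1%:Z) p.2 x' /\
    agree (c + l%:Z - p.1.+1%:Z) (c + l%:Z + p.1.+1%:Z) (Phi x') y.
  move=> [n x] /=.
  have [/exists_preimage_step[x' x'P]|nxy] := pselect
    (agree (c + l%:Z - n%:Z) (c + l%:Z + n%:Z) (Phi x) y); first by exists x'.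
  by exists x.
pose xs := fix xs n := if n is k.+1 then f (k, xs k) else a.
have xsy n : agree (c + l%:Z - n%:Z) (c + l%:Z + n%:Z) (Phi (xs n)) y.
  elim: n => [|n IHn]; first by move=> z; lia.
  by have [] := fP (n, xs n) IHn.
have xs_agree n k : agree (c - n%:Z) (c + m%:Z + n%:Z) (xs n) (xs (n + k)%N).
  elim: k => [|k IHk]; first by rewrite addn0.
  move=> z zn; rewrite IHk// addnS /=.
  have [/= xx' _] := fP ((n + k)%N, xs (n + k)%N) (xsy _).
  by apply: xx'; lia.
pose x : config A := fun z => xs `|(z - c)%R|.+1 z.
have xsx n : agree (c - n%:Z) (c + m%:Z + n%:Z) (xs n) x.
  move=> z zn; rewrite /x; set k := `|_|.+1.
  have [nk|kn] := leqP n k; first by rewrite -(subnKC nk) -xs_agree.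
  by rewrite -(subnKC (ltnW kn)) -xs_agree//; lia.
exists x; split.
  apply/funext => z; pose n := `|(z - c - l%:Z)%R|.+1.
  rewrite -(agree_image (xsx n)); last by lia.
  by apply: xsy; lia.
move=> z zc; apply/esym; apply: (xsx 0%N); lia.
Qed.

Definition config_of_block (t : m.-tuple A) : config A :=
  fun z => nth point t `|z|.

Lemma block_config_of_block t : block 0 (config_of_block t) = t.
Proof.
apply: eq_from_tnth => i; rewrite tnth_block (tnth_nth point).
by rewrite /config_of_block add0r.
Qed.

(** The point of the fibre over y whose block at the origin is t. *)
Definition preimage_at y (t : m.-tuple A) : config A :=
  projT1 (cid (exists_preimage y (config_of_block t) 0)).

Lemma preimage_atK y t : Phi (preimage_at y t) = y.
Proof. by rewrite /preimage_at; case: cid => x []. Qed.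

Lemma block_preimage_at y t : block 0 (preimage_at y t) = t.
Proof.
rewrite /preimage_at; case: cid => x [_ /eq_block /= ->].
exact: block_config_of_block.
Qed.

Lemma fibre_inj a b u :
  Phi a = Phi b -> block u a = block u b -> a = b.
Proof.
move=> Pab /block_agree ab; apply/funext => z.
apply: (@agree_extend u (u - `|z - u|) (u + m%:Z + `|z - u| + 1)) => //; [lia..| |lia].
by rewrite Pab.
Qed.

Lemma preimage_at_block x : preimage_at (Phi x) (block 0 x) = x.
Proof. by apply: (@fibre_inj _ _ 0); rewrite ?preimage_atK ?block_preimage_at. Qed.

(** By [agree_extend], a coordinate of the preimage depends on finitely many
    coordinates of y. *)
Lemma preimage_at_measurable t :
  measurable_fun setT (fun y => preimage_at y t).
Proof.
apply: config_measurable_fun => z x.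
apply: (@determined_measurable A (`|z| + l)%N _ (fun y => preimage_at y t z)).
move=> y y' yy'.
apply: (@agree_extend 0 (- `|z|) (m%:Z + `|z| + 1)); [lia..| | |lia].
  by apply: block_agree; rewrite !block_preimage_at.
by rewrite !preimage_atK; apply: agree_sub yy'; lia.
Qed.

End BipermutativeRule.

(** * Essential injectivity forces zero entropy *)

Section EntropyZero.
Context {A : pfinType} {R : realType} (Phi : config A -> config A) (l r : nat).
Variable phi : (l + r).+1.-tuple A -> A.
Hypothesis Phi_phi : has_local_rule Phi phi.
Hypothesis phiL : left_permutative_rule phi.
Hypothesis phiR : right_permutative_rule phi.
Local Notation m := (l + r)%N.
Variable mu : probability (config A) R.
Hypotheses (mPhi : measurable_fun setT Phi) (muPhi : measure_invariant mu Phi).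
Variable E : set (config A).
Hypotheses (mE : measurable E) (muE : mu E = 1%E).
Hypothesis injE : forall x y, E x -> E y -> Phi x = Phi y -> x = y.
Variables (k : nat) (P : config A -> 'I_k).
Hypothesis mP : measurable_partition P.

Local Notation block0 := (@block A l r 0).

(** F guesses the block of x at the origin from Phi x, and Q guesses the cell P x
    from x.  Nothing is recorded when both guesses are right; otherwise the true
    values are. *)
Definition correction (F : config A -> m.-tuple A) (Q : config A -> 'I_k) x :=
  if (block0 x == F (Phi x)) && (P x == Q x) then None
  else Some (block0 x, P x).

(** The block at the origin is known either from the guess F or from the recorded
    value, and spreads to [-N, N] because Phi x is known there.  The requirement
    m <= N makes the origin block fit. *)
Lemma correction_decode N F Q x x' : (m <= N)%N ->
  determined N F -> determined N Q ->
  correction F Q x = correction F Q x' ->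
  agree (- N%:Z) N.+1%:Z (Phi x) (Phi x') ->
  agree (- N%:Z) N.+1%:Z x x' /\ P x = P x'.
Proof.
move=> mN dF dQ ee ab.
have bb : block0 x = block0 x'.
  move: ee; rewrite /correction; case: ifP => [/andP[/eqP -> _]|_].
    by case: ifP => // /andP[/eqP -> _] _; exact: dF.
  by case: ifP => // _ /Some_inj/pair_equal_spec[].
have xx' : agree (- N%:Z) N.+1%:Z x x'.
  have := agree_extend Phi_phi phiL phiR (c := 0) (u := - N%:Z - l%:Z)
    (v := N.+1%:Z + r%:Z) (a := x) (b := x').
  move=> /(_ _ _ (block_agree bb) _)/wrap[]; [lia..| |].
    by apply: agree_sub ab; lia.
  by apply: agree_sub; lia.
split=> //; move: ee; rewrite /correction; case: ifP => [/andP[_ /eqP ->]|_].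
  by case: ifP => // /andP[_ /eqP ->] _; exact: dQ.
by case: ifP => // _ /Some_inj/pair_equal_spec[].
Qed.

Lemma measurable_correction N F Q : determined N F -> determined N Q ->
  measurable_fibres (correction F Q).
Proof.
move=> dF dQ.
pose W x := ((block0 x, F (Phi x)), (P x, Q x)).
have mW : measurable_fibres W.
  apply: measurable_fibres_pair; apply: measurable_fibres_pair => //.
  - move=> t; apply: (@determined_measurable A m _ block0) => a b ab.
    by apply: eq_block; apply: agree_sub ab; lia.
  - move=> t; apply: (measurable_preimage (f := Phi) (B := F @^-1` [set t])) => //.
    exact: determined_measurable dF.
  - by move=> i; exact: determined_measurable dQ.
exact: (measurable_fibres_comp
  (fun w => if (w.1.1 == w.1.2) && (w.2.1 == w.2.2) then None
            else Some (w.1.1, w.2.1)) mW).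
Qed.

(** For x in E the block of x at the origin is the only t for which the point of
    the fibre of Phi x with block t lies in E.  So it is a measurable function of
    Phi x, and it is approximated by a function of finitely many coordinates, as is
    P. *)
Lemma exists_rare_correction (eps : R) : 0 < eps ->
  exists N F Q, [/\ (m <= N)%N, determined N F, determined N Q &
    fine (mu [set x | correction F Q x != None]) <= eps].
Proof.
move=> eps0; have eps20 : 0 < eps / 2 by rewrite divr_gt0.
pose B (i : m.-tuple A + 'I_k) : set (config A) := match i with
  | inl t => (fun y => preimage_at Phi_phi phiL phiR y t) @^-1` E
  | inr i => P @^-1` [set i] end.
have mB i : measurable (B i).
  case: i => [t|i]; last exact: mP.
  by apply: measurable_preimage => //; exact: preimage_at_measurable.
have [M [C [dC Bad_lt]]] := approximation mu eps20 mB.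
set Bad := \bigcup_i _ in Bad_lt.
have mBad : measurable Bad.
  apply: fin_bigcup_measurable => [|i _]; first exact: finite_finset.
  by apply: measurable_mismatch (dC i).
pose N := maxn M m.
have dCN i : determined N (C i) by apply: determined_le (dC i); exact: leq_maxl.
pose F y := odflt [tuple point | _ < m] [pick t | C (inl t) y].
pose Q x := odflt (P point) [pick i | C (inr i) x].
have dF : determined N F.
  move=> a b ab; rewrite /F; congr odflt; apply: eq_pick => t; exact: dCN.
have dQ : determined N Q.
  move=> a b ab; rewrite /Q; congr odflt; apply: eq_pick => t; exact: dCN.
exists N, F, Q; split=> //; first exact: leq_maxr.
have ok x : E x -> ~ Bad (Phi x) -> ~ Bad x -> correction F Q x = None.
  move=> Ex bPx bx.
  have CP t : C (inl t) (Phi x) <-> t = block0 x.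
    have nM : ~ mismatch (B (inl t)) (C (inl t)) (Phi x).
      by move=> mx; apply: bPx; exists (inl t).
    have [BC CB] := mismatch_out nM.
    split=> [/CB /= Ext|tx]; last by apply: BC; rewrite tx /= preimage_at_block.
    have <- : preimage_at Phi_phi phiL phiR (Phi x) t = x.
      by apply: injE => //; rewrite preimage_atK.
    by rewrite block_preimage_at.
  have CQ i : C (inr i) x <-> i = P x.
    have nM : ~ mismatch (B (inr i)) (C (inr i)) x.
      by move=> mx; apply: bx; exists (inr i).
    have [BC CB] := mismatch_out nM.
    by split=> [/CB //|ix]; apply: BC.
  have FE : F (Phi x) = block0 x.
    rewrite /F; case: pickP => [t /CP //|/(_ (block0 x))/idP[]].
    exact/CP.
  have QE : Q x = P x.
    rewrite /Q; case: pickP => [i /CQ //|/(_ (P x))/idP[]].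
    exact/CQ.
  by rewrite /correction FE QE !eqxx.
have mc : measurable [set x | correction F Q x != None].
  exact: (measurable_fibres_preimage [set u | u != None] (measurable_correction dF dQ)).
have mPB : measurable (Phi @^-1` Bad) by exact: measurable_preimage.
rewrite -lee_fin fineK ?fin_num_measure//.
apply: (@le_trans _ _ (mu (~` E `|` (Phi @^-1` Bad `|` Bad)))).
  apply: le_measure; rewrite ?inE//.
    by apply: measurableU; [exact: measurableC | exact: measurableU].
  move=> x /= /eqP cx.
  have [Ex|] := pselect (E x); last by left.
  have [bPx|bPx] := pselect (Bad (Phi x)); first by right; left.
  have [bx|bx] := pselect (Bad x); first by right; right.
  by case: cx; exact: ok.
have mPBB : measurable (Phi @^-1` Bad `|` Bad) by exact: measurableU.
apply: (@le_trans _ _ (mu (~` E) + mu (Phi @^-1` Bad `|` Bad))%E).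
  by apply: measureU2 => //; exact: measurableC.
rewrite probability_setC// muE subee// add0e.
apply: (@le_trans _ _ (mu (Phi @^-1` Bad) + mu Bad)%E); first exact: measureU2.
rewrite muPhi// [eps]splitr EFinD.
by apply: leeD; exact: ltW.
Qed.

Lemma join_entropyE n :
  join_entropy mu Phi P n = shannon mu (fun x => [tuple P (iter i Phi x) | i < n]).
Proof.
rewrite /join_entropy /shannon; congr (- _); apply: eq_bigr => w _.
have -> // : join_cell Phi P w =
    (fun x => [tuple P (iter i Phi x) | i < n]) @^-1` [set w].
apply/seteqP; split=> x /=.
  by move=> xw; apply: eq_from_tnth => i; rewrite tnth_mktuple.
by move=> <- i; rewrite tnth_mktuple.
Qed.

Lemma join_entropy_ge0 n : 0 <= join_entropy mu Phi P n.
Proof.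
have mX : measurable_fibres (fun x => [ffun i : 'I_n => P (iter i Phi x)]).
  by apply: measurable_fibres_ffun => i u; exact: (preimage_iter_measurable mPhi i (mP u)).
have {}mX : measurable_fibres (fun x => [tuple P (iter i Phi x) | i < n]).
  rewrite (_ : (fun x => _) =
      fun x => [tuple [ffun i : 'I_n => P (iter i Phi x)] i | i < n]).
    exact: (measurable_fibres_comp (fun f : {ffun 'I_n -> 'I_k} => [tuple f i | i < n])).
  by apply/funext => x; apply: eq_mktuple => i; rewrite ffunE.
rewrite join_entropyE /shannon oppr_ge0; apply: sumr_le0 => w _.
rewrite mulr_ge0_le0 ?law_ge0// ln_le0// -(sum_law mu mX) (bigD1 w)//= lerDl.
by rewrite sumr_ge0// => *; exact: law_ge0.
Qed.

(** Decode backwards from Phi^n x seen on [-N, N], whose cost C does not depend on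
    n.  The code gives length eta to the empty correction and the large length K
    to the others; the latter are made so rare that they also cost at most eta per
    step. *)
Lemma join_entropy_sublinear (eta : R) : 0 < eta ->
  exists C : R, forall n, join_entropy mu Phi P n <= C + n%:R * (eta + eta).
Proof.
move=> eta0.
set U := option (m.-tuple A * 'I_k).
have L0 : 0 < #|{: U}|%:R :> R by rewrite ltr0n; apply/card_gt0P; exists None.
have L1 : 1 <= #|{: U}|%:R :> R by rewrite ler1n; apply/card_gt0P; exists None.
(* What the empty correction leaves of the total mass 1 in the Kraft sum is shared
   equally. *)
pose q : R := (1 - expR (- eta)) / #|{: U}|%:R.
have d0 : 0 < 1 - expR (- eta) by rewrite subr_gt0 expR_lt1 oppr_lt0.
have q0 : 0 < q by rewrite divr_gt0.
have q1 : q <= 1.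
  rewrite ler_pdivrMr// mul1r; apply: le_trans L1.
  by rewrite gerBl expR_ge0.
pose K := - ln q.
have K0 : 0 <= K by rewrite oppr_ge0 ln_le0.
pose c (u : U) := if u is Some _ then K else eta.
have kraft : \sum_u expR (- c u) <= 1.
  rewrite (bigD1 None)//= -lerBrDl.
  apply: (@le_trans _ _ (\sum_(u : U) q)).
    rewrite [leRHS](bigD1 None)//= -[leLHS]add0r; apply: lerD; first exact: ltW.
    by apply: ler_sum => -[p|]// _; rewrite /= /K opprK lnK.
  by rewrite sumr_const -[leLHS]mulr_natr divfK ?gt_eqF.
have [N [F [Q [mN dF dQ rare]]]] :
    exists N F Q, [/\ (m <= N)%N, determined N F, determined N Q &
    fine (mu [set x | correction F Q x != None]) <= eta / (K + 1)].
  by apply: exists_rare_correction; rewrite divr_gt0// ltr_wpDl.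
have mc := measurable_correction dF dQ.
pose Y n x := [ffun i : 'I_(N + N).+1 => (iter n Phi x : config A) (i%:Z - N%:Z)].
exists (ln #|{ffun 'I_(N + N).+1 -> A}|%:R) => n.
rewrite join_entropyE.
have mY : measurable_fibres (Y n).
  apply: measurable_fibres_ffun => i x.
  apply: (preimage_iter_measurable mPhi n (B := [set a : config A | a (i%:Z - N%:Z) = x])).
  exact: measurable_config_open (open_coordinate _ _).
apply: le_trans (shannon_stationary_code mPhi muPhi (n := n) mY mc _ kraft) _.
  move=> x x' YY ee.
  have decode j : (j <= n)%N ->
      agree (- N%:Z) N.+1%:Z (iter (n - j) Phi x) (iter (n - j) Phi x').
    elim: j => [_|j IHj jn].
      rewrite subn0 => z zN.
      have zlt : (`|(z + N%:Z)%R| < (N + N).+1)%N by lia.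
      move/ffunP/(_ (Ordinal zlt)): YY; rewrite !ffunE /=.
      by rewrite (_ : _ - _ = z)//; lia.
    have := IHj (ltnW jn); rewrite -(subnSK jn) /= => ab.
    have jlt : (n - j.+1 < n)%N by rewrite ltn_subrL (leq_ltn_trans _ jn).
    by case: (correction_decode mN dF dQ (ee _ jlt) ab).
  apply: eq_mktuple => i; have i_n := ltn_ord i.
  have := decode (n - i.+1)%N _; rewrite subKn// => /(_ (leq_subr _ _)) /= ab.
  by case: (correction_decode mN dF dQ (ee i i_n) ab).
rewrite lerD2l ler_wpM2l//.
rewrite (bigD1 None)//=; apply: lerD.
  rewrite ger_pMl//; rewrite -(sum_law mu mc) (bigD1 None)//= lerDl.
  by rewrite sumr_ge0// => *; exact: law_ge0.
apply: (@le_trans _ _ (\sum_(u | u != None) law mu (correction F Q) u * K)).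
  by apply: ler_sum => -[p|].
rewrite -mulr_suml -(law_preimage mu (fun u => u != None))//.
apply: le_trans (ler_wpM2r K0 rare) _.
have K10 : 0 < K + 1 by rewrite ltr_wpDl.
by rewrite mulrAC ler_pdivrMr// ler_pM2l// lerDl.
Qed.

Lemma partition_entropy_eq0 : partition_entropy mu Phi P = 0.
Proof.
apply/cvg_lim => //; apply/cvgr0Pnorm_le => eps eps0.
have [C HC] := join_entropy_sublinear (divr_gt0 eps0 (ltr0n R 4)).
near=> n.
have n0 : 0 < n%:R :> R by rewrite ltr0n; near: n; exact: nbhs_infty_gt.
have nC : C <= n%:R * (eps / 2).
  rewrite -ler_pdivrMr ?divr_gt0//; near: n; exact: nbhs_infty_ger.
rewrite ger0_norm; last by rewrite divr_ge0// join_entropy_ge0.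
rewrite ler_pdivrMr//.
by apply: le_trans (HC n) _; lra.
Unshelve. all: by end_near. Qed.

End EntropyZero.

(** * Group shifts and rigidity *)

Section GroupShift.
Context {A : pfinType} (G : group_shift A).
Implicit Types (a b x k : config A).
Local Notation "a \* b" := (gmul G a b) (at level 40, left associativity).
Local Notation "1" := (gone G).

(** The axioms only provide a left unit and left inverses. *)
Lemma gmulgV a : a \* ginv G a = 1.
Proof.
rewrite -[LHS](gmul1 G) -{1}(gmulV G (ginv G a)) -(gmulA G).
by rewrite (gmulA G (ginv G a) a) (gmulV G) (gmul1 G) (gmulV G).
Qed.

Lemma gmulg1 a : a \* 1 = a.
Proof. by rewrite -(gmulV G a) (gmulA G) gmulgV (gmul1 G). Qed.

Lemma gmulKg a b : ginv G a \* (a \* b) = b.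
Proof. by rewrite (gmulA G) (gmulV G) (gmul1 G). Qed.

Lemma gmulVKg a b : a \* (ginv G a \* b) = b.
Proof. by rewrite (gmulA G) gmulgV (gmul1 G). Qed.

Lemma gmul_idem a : a \* a = a -> a = 1.
Proof. by move=> aa; rewrite -(gmulKg a a) aa (gmulV G). Qed.

Lemma translation_measurable k : measurable_fun setT (fun x => x \* k).
Proof.
apply: continuous_measurable_config => x.
apply: (@continuous_comp _ _ _ (fun x => (x, k)) (fun p => gmul G p.1 p.2)).
  move=> U [[V W] /= [xV kW] VWU]; apply: filterS xV => x' Vx'.
  by apply: VWU; split=> //; exact: nbhs_singleton kW.
exact: gmul_continuous.
Qed.

Lemma cshift_one : cshift 1 = 1.
Proof. by apply: gmul_idem; rewrite -shift_gmul (gmul1 G). Qed.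

Lemma shift_iter_gmul n a b :
  iter n (@cshift A) (a \* b) = iter n (@cshift A) a \* iter n (@cshift A) b.
Proof. by elim: n => //= n ->; rewrite shift_gmul. Qed.

End GroupShift.

Section Shift.
Context {A : pfinType}.

Definition cunshift (a : config A) : config A := fun z => a (z + 1).

Lemma cshiftK : cancel (@cshift A) cunshift.
Proof. by move=> a; apply/funext => z; rewrite /cunshift /cshift addrK. Qed.

Lemma cunshiftK : cancel cunshift (@cshift A).
Proof. by move=> a; apply/funext => z; rewrite /cunshift /cshift subrK. Qed.

Lemma cshift_measurable : measurable_fun setT (@cshift A).
Proof.
apply: config_measurable_fun => z x.
exact: measurable_config_open (open_coordinate (z - 1) x).
Qed.

Lemma cunshift_measurable : measurable_fun setT cunshift.
Proof.
apply: config_measurable_fun => z x.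
exact: measurable_config_open (open_coordinate (z + 1) x).
Qed.

End Shift.

Section Rigidity.
Context {A : pfinType} {R : realType} (G : group_shift A).
Variables (Phi : config A -> config A) (l r : nat).
Variable phi : (l + r).+1.-tuple A -> A.
Hypothesis Phi_phi : has_local_rule Phi phi.
Hypothesis phiL : left_permutative_rule phi.
Hypothesis phiR : right_permutative_rule phi.
Hypothesis PhiS : forall a, Phi (cshift a) = cshift (Phi a).
Hypothesis PhiG : endomorphic G Phi.
Local Notation m := (l + r)%N.
Implicit Types (a b x k : config A) (z u v : int).
Local Notation "a \* b" := (gmul G a b) (at level 40, left associativity).
Local Notation "1" := (gone G).
Local Notation K := (group_kernel G Phi).
Local Notation sigma := (@cshift A).
Local Notation block0 := (@block A l r 0).

Lemma Phi1 : Phi 1 = 1.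
Proof. by apply: (gmul_idem (G := G)); rewrite -PhiG (gmul1 G). Qed.

Lemma Phi_gmulK x k : K k -> Phi (x \* k) = Phi x.
Proof. by move=> Kk; rewrite PhiG Kk gmulg1. Qed.

Lemma kernel_fibre x y : Phi x = Phi y -> K (ginv G x \* y).
Proof.
move=> xy; rewrite /group_kernel /= PhiG -xy -PhiG (gmulV G); exact: Phi1.
Qed.

Lemma kernel_subgroup : is_subgroup G K.
Proof.
split; first exact: Phi1.
  by move=> a b Ka Kb; rewrite /group_kernel /= Phi_gmulK.
move=> a Ka; rewrite -[ginv G a](gmulg1 G); apply: kernel_fibre.
by rewrite Phi1.
Qed.

Lemma kernel_shift k : K k -> K (sigma k).
Proof. by move=> Kk; rewrite /group_kernel /= PhiS Kk cshift_one. Qed.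

Lemma kernel_unshift k : K (sigma k) -> K k.
Proof.
move=> Kk; rewrite /group_kernel /= -[Phi k]cshiftK -PhiS Kk.
by rewrite -[in LHS](cshift_one G) cshiftK.
Qed.

Lemma kernel_block_inj k k' : K k -> K k' -> block0 k = block0 k' -> k = k'.
Proof. by move=> Kk Kk'; apply: (fibre_inj Phi_phi phiL phiR); rewrite Kk Kk'. Qed.

Definition kernel_elt (t : m.-tuple A) := preimage_at Phi_phi phiL phiR 1 t.

Lemma kernel_eltP t : K (kernel_elt t).
Proof. exact: preimage_atK. Qed.

Lemma block_kernel_elt t : block0 (kernel_elt t) = t.
Proof. exact: block_preimage_at. Qed.

Lemma kernel_elt_block k : K k -> kernel_elt (block0 k) = k.
Proof.
by move=> Kk; apply: kernel_block_inj => //; [exact: kernel_eltP | exact: block_kernel_elt].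
Qed.

(** The shift permutes K, which is in bijection with the blocks at the origin; n is
    the order of the permutation of blocks that it induces. *)
Lemma shift_period : exists2 n, (1 <= n)%N & forall k, K k -> iter n sigma k = k.
Proof.
pose f t := block0 (sigma (kernel_elt t)).
have injf : injective f.
  move=> t t' /kernel_block_inj tt'.
  rewrite -[t]block_kernel_elt -[t']block_kernel_elt; congr block.
  by apply: (can_inj cshiftK); apply: tt'; apply: kernel_shift; exact: kernel_eltP.
pose p := perm injf.
have iterp n t : (p ^+ n)%g t = block0 (iter n sigma (kernel_elt t)) /\
    K (iter n sigma (kernel_elt t)).
  elim: n => [|n [IHn Kn]].
    by rewrite expg0 perm1 block_kernel_elt; split=> //; exact: kernel_eltP.
  split; last exact: kernel_shift.
  by rewrite expgSr permM IHn permE /f kernel_elt_block.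
exists #[p]%g; first exact: order_gt0.
move=> k Kk; have [bk Kn] := iterp #[p]%g (block0 k).
apply: kernel_block_inj => //; first by rewrite -(kernel_elt_block Kk).
by rewrite -{1}(kernel_elt_block Kk) -bk expg_order perm1.
Qed.

Variable mu : probability (config A) R.
Hypothesis muS : measure_invariant mu sigma.

Definition translate_invariant k :=
  forall B, measurable B -> mu ((fun x => x \* k) @^-1` B) = mu B.

Definition stabilizer := K `&` translate_invariant.

Let measurable_translate k B :
  measurable B -> measurable ((fun x => x \* k) @^-1` B).
Proof. exact: measurable_preimage (translation_measurable G k). Qed.

Lemma stabilizer_subgroup : is_subgroup G stabilizer.
Proof.
have [K1 KM KV] := kernel_subgroup.
split.
- split=> // B mB; congr (mu _); by apply/seteqP; split=> x /=; rewrite gmulg1.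
- move=> a b [Ka Ja] [Kb Jb]; split; first exact: KM.
  move=> B mB; rewrite -[RHS]Jb// -[RHS]Ja; last exact: measurable_translate.
  by congr (mu _); apply/seteqP; split=> x /=; rewrite (gmulA G).
- move=> a [Ka Ja]; split; first exact: KV.
  move=> B mB; rewrite -[LHS]Ja; last exact: measurable_translate.
  congr (mu _); apply/seteqP; split=> x /=; rewrite -(gmulA G) gmulgV gmulg1//.
Qed.

Lemma stabilizer_shift_invariant : shift_invariant_set stabilizer.
Proof.
have mS := @cshift_measurable A; have mS' := @cunshift_measurable A.
apply/seteqP; split.
  move=> _ [k [Kk Jk] <-]; split; first exact: kernel_shift.
  move=> B mB; rewrite -muS; last exact: measurable_translate.
  rewrite -[RHS]muS// -[RHS]Jk; last exact: measurable_preimage.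
  by congr (mu _); apply/seteqP; split=> x /=; rewrite shift_gmul.
move=> k [Kk Jk]; exists (cunshift k); last exact: cunshiftK.
split; first by apply: kernel_unshift; rewrite cunshiftK.
move=> B mB; have mB' : measurable (cunshift @^-1` B) by exact: measurable_preimage.
have -> : B = sigma @^-1` (cunshift @^-1` B).
  by apply/seteqP; split=> x /=; rewrite cshiftK.
rewrite muS// -[RHS]Jk// -[RHS]muS; last exact: measurable_translate.
congr (mu _); apply/seteqP; split=> x /=; by rewrite shift_gmul cunshiftK.
Qed.

Hypothesis ergS : totally_shift_ergodic mu.

(** A power of the shift that fixes k commutes with the translation by k, so the
    translated measure is ergodic for it as well. *)
Lemma translate_eq_or_singular k : K k ->
  translate_invariant k \/ exists P, [/\ measurable P, mu P = 1%E &
    mu ((fun x => x \* k) @^-1` P) = 0%E].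
Proof.
move=> Kk; have [n n1 fixK] := shift_period.
have mS := @cshift_measurable A; have mS' := @cunshift_measurable A.
have mSn : measurable_fun setT (iter n sigma).
  by move=> _ B mB; rewrite setTI; exact: preimage_iter_measurable.
have mS'n : measurable_fun setT (iter n (@cunshift A)).
  by move=> _ B mB; rewrite setTI; exact: preimage_iter_measurable.
have iterK f g (fg : cancel f g) : cancel (iter n f) (iter n g : config A -> config A).
  by elim: (n) => [//|j IHj] x; rewrite iterSr /= fg IHj.
have translate_iter x : iter n sigma (x \* k) = iter n sigma x \* k.
  by rewrite shift_iter_gmul (fixK _ Kk).
pose X : {mfun config A >-> config A} := HB.pack (fun x => x \* k)
  (isMeasurableFun.Build _ _ _ _ _ (translation_measurable G k)).
have Imu : measure_invariant mu (iter n sigma) by exact: measure_invariant_iter.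
have [_ /(_ n n1) Emu] := ergS.
have preE B : (fun x => x \* k) @^-1` (iter n sigma @^-1` B) =
    iter n sigma @^-1` ((fun x => x \* k) @^-1` B).
  by apply/seteqP; split=> x /=; rewrite translate_iter.
have Inu : measure_invariant (distribution mu X) (iter n sigma).
  move=> B mB; rewrite -[LHS]/(mu ((fun x => x \* k) @^-1` _)) preE.
  by rewrite Imu//; exact: measurable_translate.
have Enu : ergodic (distribution mu X) (iter n sigma).
  move=> B mB SB; apply: (Emu ((fun x => x \* k) @^-1` B)).
    exact: measurable_translate.
  by rewrite -preE SB.
have [eq_mn|[P [mP muP nuP]]] := ergodic_eq_or_singular (iterK _ _ cshiftK)
  (iterK _ _ cunshiftK) mSn mS'n Imu Inu Emu Enu.
  by left=> B mB; rewrite [RHS]eq_mn.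
by right; exists P.
Qed.

(** E consists of the points x such that, for every k <> 1 in K, x lies in the set
    P that separates mu from its translate by k while x k does not.  Two points
    x and x k of E would contradict this. *)
Lemma trivial_stabilizer_injective : stabilizer = [set 1] ->
  exists E, [/\ measurable E, mu E = 1%E &
    forall x y, E x -> E y -> Phi x = Phi y -> x = y].
Proof.
move=> J1.
have /choice[P PP] : forall t : m.-tuple A, exists P, kernel_elt t <> 1 ->
    [/\ measurable P, mu P = 1%E &
       mu ((fun x => x \* kernel_elt t) @^-1` P) = 0%E].
  move=> t; have [k1|k1] := pselect (kernel_elt t = 1); first by exists setT.
  have [Jk|[P HP]] := translate_eq_or_singular (kernel_eltP t); last by exists P.
  have : stabilizer (kernel_elt t) by split=> //; exact: kernel_eltP.
  by rewrite J1 => /k1.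
pose bad t := ~` P t `|` (fun x => x \* kernel_elt t) @^-1` P t.
pose D := [set t | kernel_elt t <> 1].
have mP t : D t -> measurable (P t) by move=> /PP[].
have mbad t : D t -> measurable (bad t).
  move=> Dt; apply: measurableU; first exact: measurableC (mP _ Dt).
  exact: measurable_translate (mP _ Dt).
have bad0 t : D t -> mu (bad t) = 0%E.
  move=> Dt; have [_ P1 P0] := PP t Dt.
  have PC0 : mu (~` P t) = 0%E by rewrite probability_setC ?P1 ?subee//; exact: mP.
  apply: null_set_setU PC0 P0; first exact: measurableC (mP _ Dt).
  exact: measurable_translate (mP _ Dt).
have finD : finite_set D by exact: finite_finset.
have mU : measurable (\bigcup_(t in D) bad t) by exact: fin_bigcup_measurable.
exists (~` (\bigcup_(t in D) bad t)); split; first exact: measurableC.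
  rewrite probability_setC// (_ : mu _ = 0%E) ?sube0//.
  apply/eqP; rewrite eq_le measure_ge0 andbT.
  apply: (@le_trans _ _ (\sum_(t \in D) mu (bad t))%E).
    exact: content_sub_fsum.
  by rewrite fsbig1// => t /bad0.
move=> x y Ex Ey xy.
have Kk := kernel_fibre xy; set k := _ \* _ in Kk.
have ykE : y = x \* k by rewrite /k gmulVKg.
have [k1|k1] := pselect (k = 1); first by rewrite ykE k1 gmulg1.
have kE := kernel_elt_block Kk; set t := block0 k in kE.
have Dt : D t by rewrite /D /= kE.
case: Ex; exists t => //; right; rewrite /= kE -ykE.
by apply: contrapT => nPy; apply: Ey; exists t => //; left.
Qed.

Section FullStabilizer.
Hypothesis muPhi : measure_invariant mu Phi.
Hypothesis muK : forall k, K k -> translate_invariant k.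
Local Notation N := #|A|%:R.

Definition word_cylinder u (n : nat) a := [set x | agree u (u + n%:Z) x a].

Lemma measurable_word_cylinder u n a : measurable (word_cylinder u n a).
Proof.
apply: measurable_config_open.
have -> : word_cylinder u n a = cylinder [seq u + i%:Z | i <- iota 0 n] a.
  apply/seteqP; split=> x xa z; first by move=> /mapP[i]; rewrite mem_iota => ni ->; apply: xa; lia.
  move=> zu; apply: xa; apply/mapP; exists `|(z - u)%R|%N; last by lia.
  by rewrite mem_iota; lia.
exact: open_cylinder.
Qed.

(** Each coset of K lying over the cylinder of Phi a has exactly one point in the
    cylinder of a, so the translates of the latter by K partition the preimage of the
    former; they all have the same mass. *)
Lemma word_cylinder_step u n a :
  mu (word_cylinder u (m + n) a) =
  ((N ^- m)%:E * mu (word_cylinder (u + l%:Z) n (Phi a)))%E.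
Proof.
set C := word_cylinder u (m + n) a; set C' := word_cylinder _ _ _.
have mC : measurable C by exact: measurable_word_cylinder.
have mC' : measurable C' by exact: measurable_word_cylinder.
pose F t := (fun x => x \* kernel_elt t) @^-1` C.
have FE : Phi @^-1` C' = \bigcup_(t in setT) F t.
  apply/seteqP; split=> [x xC'|x [t _ xC] z zu]; last first.
    rewrite -(Phi_gmulK x (kernel_eltP t)).
    by apply: (agree_image Phi_phi xC); lia.
  have [y [yx ya]] := exists_preimage Phi_phi phiL phiR (Phi x) a u.
  have Kk := kernel_fibre (esym yx).
  exists (block0 (ginv G x \* y)) => //.
  rewrite /F /= kernel_elt_block// gmulVKg.
  apply: (agree_extend Phi_phi phiL phiR _ _ ya); [lia..|].
  by rewrite yx; apply: agree_sub xC'; lia.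
have tF : trivIset setT F.
  move=> t t' _ _ [x [xt xt']].
  have xx' : x \* kernel_elt t = x \* kernel_elt t'.
    apply: (fibre_inj Phi_phi phiL phiR (u := u)).
      by rewrite !Phi_gmulK//; exact: kernel_eltP.
    apply: eq_block => z zu; rewrite xt; last by lia.
    by rewrite xt'//; lia.
  rewrite -[t]block_kernel_elt -[t']block_kernel_elt.
  by rewrite -[kernel_elt t](gmulKg G x) xx' gmulKg.
have mF t : measurable (F t) by exact: measurable_translate.
have : mu C' = (\sum_(t : m.-tuple A) mu C)%E.
  rewrite -muPhi// FE (_ : [set: _] = [set` enum {: m.-tuple A}]); last first.
    by apply/seteqP; split=> t //= _; rewrite mem_enum.
  rewrite measure_fin_bigcup//; last exact: sub_trivIset tF.
  rewrite -fsbig_seq ?enum_uniq// big_enum /=; apply: eq_bigr => t _.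
  by apply: muK => //; exact: kernel_eltP.
move=> ->; rewrite -[mu C]fineK ?fin_num_measure// sumEFin -EFinM; congr EFin.
rewrite sumr_const card_tuple -[X in _ * X]mulr_natl natrX mulKf//.
by rewrite expf_neq0// pnatr_eq0 -lt0n card_alphabet_gt0.
Qed.

(** Only the lengths that are multiples of m are reached by this induction. *)
Lemma word_cylinder_mass u j a : mu (word_cylinder u (j * m) a) = (N ^- (j * m))%:E.
Proof.
elim: j u a => [|j IHj] u a.
  rewrite mul0n expr0 invr1 (_ : word_cylinder _ _ _ = setT) ?probability_setT//.
  by apply/seteqP; split=> // x _ z; lia.
by rewrite mulSn word_cylinder_step IHj -EFinM (exprD _ m) invfM.
Qed.

(** Summing over the values at z removes the constraint at z. *)
Lemma cylinder_uncons z (s : seq int) : z \notin s ->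
  (forall w, mu (cylinder (z :: s) w) = (N ^- (size s).+1)%:E) ->
  forall w, mu (cylinder s w) = (N ^- size s)%:E.
Proof.
move=> zs muzs w.
pose F (x : A) := cylinder (z :: s) (fun y => if y == z then x else w y).
have FE : cylinder s w = \bigcup_(v in [set` enum A]) F v.
  apply/seteqP; split=> [a aw|a [v _ av] y ys].
    exists (a z) => [|y]; first by rewrite /= mem_enum.
    by rewrite inE; case: eqVneq => [->//|_ /= /aw].
  rewrite av ?inE ?ys ?orbT// ifF//.
  by apply: contraNF zs => /eqP <-.
rewrite FE measure_fin_bigcup//.
- rewrite -fsbig_seq ?enum_uniq// big_enum /=.
  rewrite (eq_bigr (fun _ => (N ^- (size s).+1)%:E)); last by move=> v _; exact: muzs.
  rewrite sumEFin sumr_const -[_ *+ _]mulr_natr exprSr invfM -mulrA mulVf ?mulr1//.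
  by rewrite pnatr_eq0 -lt0n card_alphabet_gt0.
- move=> v v' _ _ [a [av av']].
  have := av z (mem_head _ _); rewrite eqxx => <-.
  by have := av' z (mem_head _ _); rewrite eqxx => <-.
- by move=> v _; exact: measurable_config_open (open_cylinder _ _).
Qed.

(** The finite set s of positions is completed to an interval whose length is a multiple of
    m, and the added positions t are then removed one at a time. *)
Lemma full_stabilizer_uniform : (0 < m)%N -> is_uniform_bernoulli mu.
Proof.
move=> m0 s w us.
pose M := (\max_(z <- s) `|z|)%N.
have sM z : z \in s -> (`|z| <= M)%N by move=> zs; rewrite /M (big_rem z)//= leq_maxl.
pose W := [seq i%:Z - M%:Z | i <- iota 0 ((M + M).+1 * m)].
have uW : uniq W by rewrite map_inj_uniq ?iota_uniq// => i j; lia.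
have sW z : z \in s -> z \in W.
  move=> /sM zM; apply/mapP; exists `|(z + M%:Z)%R|%N; last by lia.
  by rewrite mem_iota; nia.
pose t := [seq z <- W | z \notin s].
have perm_ts : perm_eq (t ++ s) W.
  apply: uniq_perm => //.
    rewrite cat_uniq us filter_uniq//= andbT; apply/hasPn => z zs.
    by rewrite mem_filter zs.
  move=> z; rewrite mem_cat mem_filter; have := sW z.
  by case: (z \in s) => /=; [move=> -> | rewrite orbF].
have ut : uniq (t ++ s) by rewrite (perm_uniq perm_ts).
have mu_ts w' : mu (cylinder (t ++ s) w') = (N ^- size (t ++ s))%:E.
  rewrite (perm_size perm_ts) size_map size_iota.
  rewrite -(word_cylinder_mass (- M%:Z) _ w'); congr (mu _).
  apply/seteqP; split=> a aw z zW; apply: aw; move: zW;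
    rewrite (perm_mem perm_ts).
    move=> zM; apply/mapP; exists `|(z + M%:Z)%R|%N; last by lia.
    by rewrite mem_iota; lia.
  by move=> /mapP[i]; rewrite mem_iota => iM ->; lia.
elim: t {perm_ts} ut mu_ts => [_ mu_s|z t' IHt]; first exact: mu_s.
rewrite cat_cons /= => /andP[zt ut] mu_zt; apply: IHt => //.
exact: cylinder_uncons mu_zt.
Qed.

End FullStabilizer.

End Rigidity.

Theorem theorem34 (R : realType) (A : pfinType) (G : group_shift A)
    (Phi : config A -> config A) (mu : probability (config A) R) :
  cellular_automaton Phi ->
  bipermutative Phi ->
  endomorphic G Phi ->
  (forall J : set (config A), shift_invariant_set J ->
     ~ nontrivial_subgroup_of G (group_kernel G Phi) J) ->
  measure_invariant mu Phi ->
  totally_shift_ergodic mu ->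
  (0 < entropy mu Phi)%E ->
  forall B : set (config A), measurable B -> mu B = uniform_bernoulli A R B.
Proof.
move=> [cPhi PhiS] [l [r [phi [Phi_phi phiL phiR]]]] PhiG noJ muPhi ergS h0.
apply: uniform_bernoulli_unique (@uniform_bernoulliP A R).
have [muS _] := ergS.
have mPhi := continuous_measurable_config cPhi.
pose J := stabilizer G Phi mu.
have J_not1 : J <> [set gone G].
  move=> /(trivial_stabilizer_injective Phi_phi phiL phiR PhiS PhiG muS ergS).
  move=> [E [mE muE injE]].
  have [_ [k [P [mP ->]]]] := ereal_sup_gt h0.
  by rewrite (partition_entropy_eq0 Phi_phi phiL phiR mPhi muPhi mE muE injE mP) ltxx.
have JK : J = group_kernel G Phi.
  apply: contrapT => JnK.
  apply: (noJ J); first exact: stabilizer_shift_invariant.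
  split=> //; first exact: stabilizer_subgroup.
  by move=> k [].
apply: (full_stabilizer_uniform Phi_phi phiL phiR PhiG muPhi) => [k Kk|].
  by have [] : J k by rewrite JK.
rewrite lt0n; apply/eqP => m0; apply: J_not1; rewrite JK.
apply/seteqP; split=> [k Kk|_ ->]; last exact: Phi1.
apply: (kernel_block_inj Phi_phi phiL phiR Kk (Phi1 PhiG)).
by apply: eq_block => z; lia.
Qed.
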